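(* A type-definable Lascar strong type of a hyperimaginary over a hyperimaginary has finite diameter. That is: let $T$ be a complete first-order theory with monster model $\mathcal M$, let $\boldsymbol e=a/E$ and $b_F$ be hyperimaginaries, and suppose that there is a partial type $\pi_0(x)$ over some small real set such that for every real tuple $d$, $d\models\pi_0(x)$ iff $d_F\equiv^{\operatorname L}_{\boldsymbol e}b_F$. Then the Lascar diameter of $b_F$ over $\boldsymbol e$ is finite.
   Context: Conventions: $\mathcal M$ is a ($\bar\kappa$-saturated) monster model of $T$; small means of cardinality $<\bar\kappa$; real tuples are sequences from $\mathcal M$ of small length. A hyperimaginary $b_F=b/F$ is the class of a real tuple $b$ modulo an $\emptyset$-type-definable equivalence relation $F$. $E$ is an $\emptyset$-type-definable equivalence relation, $a$ a real tuple, $\boldsymbol e=a/E$. $\operatorname{Aut}_{\boldsymbol e}(\mathcal M)=\{f\in\operatorname{Aut}(\mathcal M): f(\boldsymbol e)=\boldsymbol e\}$. $\operatorname{Autf}_{\boldsymbol e}(\mathcal M)$ is the subgroup of $\operatorname{Aut}_{\boldsymbol e}(\mathcal M)$ generated by all $f\in\operatorname{Aut}_{\boldsymbol e}(\mathcal M)$ fixing pointwise some small model $M\prec\mathcal M$ with $\boldsymbol e\in\operatorname{dcl}(M)$ (i.e. $\boldsymbol e$ is fixed by all automorphisms fixing $M$ pointwise). $b_F\equiv^{\operatorname L}_{\boldsymbol e}c_F$ (same Lascar strong type over $\boldsymbol e$) iff there is $f\in\operatorname{Autf}_{\boldsymbol e}(\mathcal M)$ with $f(b_F)=c_F$. A sequence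 of hyperimaginaries $(b_i/F\mid i<\omega)$ is $\boldsymbol e$-indiscernible if for every $n$ and all $i_0<\dots<i_n$, some $f\in\operatorname{Aut}_{\boldsymbol e}(\mathcal M)$ maps $(b_0/F,\dots,b_n/F)$ to $(b_{i_0}/F,\dots,b_{i_n}/F)$. The Lascar distance satisfies $d_{\boldsymbol e}(b_F,d_F)\le n$ if there are real tuples $b=b_0,b_1,\dots,b_n=d$ such that for each $i<n$, $b_i/F,b_{i+1}/F$ are the first two terms of an $\boldsymbol e$-indiscernible sequence; if this holds for some $n<\omega$, $d_{\boldsymbol e}(b_F,d_F)$ is the least such $n$. (One has $b_F\equiv^{\operatorname L}_{\boldsymbol e}d_F$ iff $d_{\boldsymbol e}(b_F,d_F)\le n$ for some $n<\omega$.) The Lascar diameter of $b_F$ over $\boldsymbol e$ is $\max\{d_{\boldsymbol e}(b_F,d_F)\mid b_F\equiv^{\operatorname L}_{\boldsymbol e}d_F\}$ if it exists, and $\infty$ otherwise. *)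

(* Defs.v *)
From Stdlib Require Export RelationClasses.
From HB Require Export structures.
From mathcomp Require Export all_boot.
From mathcomp Require Export boolp classical_sets functions cardinality.

Set Implicit Arguments.
Unset Strict Implicit.
Unset Printing Implicit Defensive.

Local Open Scope classical_set_scope.
Local Open Scope card_scope.

Record language := Language {
  func : Type;
  rel_sym : Type;
  func_ar : func -> nat;
  rel_ar : rel_sym -> nat }.

(* The free variables of a formula are the elements of an arbitrary type [V],
   so that a formula in the variables of an infinite tuple is again a
   [formula]; a quantifier binds the variable [None] of [option V]. *)
Inductive term (L : language) (V : Type) : Type :=
| Var of V
| App (g : func L) of ('I_(func_ar g) -> term L V).

Inductive formula (L : language) (V : Type) : Type :=
| FBot
| FEq of term L V & term L V
| FRel (r : rel_sym L) of ('I_(rel_ar r) -> term L V)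
| FImp of formula L V & formula L V
| FAll of formula L (option V).

Definition sentence (L : language) := formula L void.
Definition theory (L : language) := set (sentence L).

Record structure (L : language) := Structure {
  carrier :> Type;
  carrier_inh : inhabited carrier;
  func_int : forall g : func L, ('I_(func_ar g) -> carrier) -> carrier;
  rel_int : forall r : rel_sym L, ('I_(rel_ar r) -> carrier) -> Prop }.

Fixpoint teval (L : language) (M : structure L) (V : Type) (v : V -> M)
    (t : term L V) : M :=
  match t with
  | Var x => v x
  | App g ts => func_int (fun i => teval v (ts i))
  end.

Definition extend (M V : Type) (v : V -> M) (m : M) (o : option V) : M :=
  if o is Some x then v x else m.

Fixpoint sat (L : language) (M : structure L) (V : Type) (phi : formula L V) :
    (V -> M) -> Prop :=
  match phi with
  | FBot => fun _ => False
  | FEq s t => fun v => teval v s = teval v t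
  | FRel r ts => fun v => rel_int (fun i => teval v (ts i))
  | FImp phi1 phi2 => fun v => sat phi1 v -> sat phi2 v
  | FAll phi1 => fun v => forall m : M, sat phi1 (extend v m)
  end.

Definition holds (L : language) (M : structure L) (phi : sentence L) : Prop :=
  sat phi (@of_void M).

Definition is_model (L : language) (T : theory L) (M : structure L) : Prop :=
  forall phi, T phi -> holds M phi.

Definition complete_theory (L : language) (T : theory L) : Prop :=
  (exists N : structure L, is_model T N) /\
  forall phi : sentence L,
    (forall N : structure L, is_model T N -> holds N phi) \/
    (forall N : structure L, is_model T N -> ~ holds N phi).

(* A partial type in the variables [V] over [A] uses formulas whose free
   variables are [inl x] with [x : V] and parameters [inr m] with [m] in [A]. *)
Definition partial_type (L : language) (M : structure L) (A : set M)
    (V : Type) := set (formula L (V + set_type A)).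

Definition with_params (M : Type) (A : set M) (V : Type) (d : V -> M)
    (x : V + set_type A) : M :=
  match x with inl y => d y | inr m => \val m end.

Definition realizes (L : language) (M : structure L) (A : set M) (V : Type)
    (d : V -> M) (p : partial_type A V) : Prop :=
  forall phi, p phi -> sat phi (with_params d).

Definition same_type (L : language) (M : structure L) (V : Type)
    (c d : V -> M) : Prop :=
  forall phi : formula L V, sat phi c <-> sat phi d.

(* A cardinal is represented by a type [K] of that cardinality;
   [small K A] says that the cardinality of [A] is less than it. *)
Definition small (K : Type) (U : Type) (A : set U) : Prop :=
  ~ ([set: K] #<= A).

Definition saturated (K : Type) (L : language) (M : structure L) : Prop :=
  forall (A : set M), small K A ->
  forall p : partial_type A unit,
    (forall q : partial_type A unit, finite_set q -> q `<=` p ->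
       exists c, realizes c q) ->
    exists c, realizes c p.

Definition automorphism (L : language) (M : structure L) (f : M -> M) : Prop :=
  [/\ bijective f,
      forall (g : func L) (ms : 'I_(func_ar g) -> M),
        f (func_int ms) = func_int (f \o ms)
    & forall (r : rel_sym L) (ms : 'I_(rel_ar r) -> M),
        rel_int ms <-> rel_int (f \o ms)].

Definition strongly_homogeneous (K : Type) (L : language) (M : structure L) :
    Prop :=
  forall (I : Type), small K [set: I] ->
  forall c d : I -> M, same_type c d ->
  exists2 f, automorphism f & f \o c = d.

(* The first three conditions say that the cardinal [K] is greater than
   |L| + aleph_0. *)
Definition monster (K : Type) (L : language) (T : theory L) (M : structure L) :
    Prop :=
  [/\ small K [set: nat], small K [set: func L] & small K [set: rel_sym L]] /\
  [/\ is_model T M, saturated K M & strongly_homogeneous K M].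

Definition elementary (L : language) (N M : structure L) (h : N -> M) : Prop :=
  forall (phi : formula L nat) (v : nat -> N), sat phi v <-> sat phi (h \o v).

(* The universe of an elementary substructure, given as the image of an
   elementary embedding. *)
Definition elementary_sub (L : language) (M : structure L) (A : set M) : Prop :=
  exists (N : structure L) (h : N -> M), elementary h /\ range h = A.

Definition typedef_equiv (L : language) (M : structure L) (I : Type)
    (F : (I -> M) -> (I -> M) -> Prop) : Prop :=
  (exists Phi : set (formula L (I + I)), forall c d,
     F c d <-> forall phi, Phi phi ->
                 sat phi (fun x => match x with inl i => c i | inr i => d i end))
  /\ Equivalence F.

Definition hyp (M I : Type) (F : (I -> M) -> (I -> M) -> Prop) (c : I -> M) :
    set (I -> M) := [set d | F c d].

Definition hyp_act (M I : Type) (f : M -> M) (X : set (I -> M)) :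
    set (I -> M) := [set f \o c | c in X].

Section Over.

Context (K : Type) (L : language) (M : structure L) (J : Type)
  (e : set (J -> M)).

Definition aut_over (f : M -> M) : Prop :=
  automorphism f /\ hyp_act f e = e.

Definition fixes_pointwise (A : set M) (f : M -> M) : Prop :=
  forall m, A m -> f m = m.

Definition in_dcl (A : set M) : Prop :=
  forall f, automorphism f -> fixes_pointwise A f -> hyp_act f e = e.

Inductive autf_over : (M -> M) -> Prop :=
| autf_gen f (A : set M) : aut_over f ->
    elementary_sub A -> small K A -> in_dcl A -> fixes_pointwise A f ->
    autf_over f
| autf_id : autf_over id
| autf_comp f g : autf_over f -> autf_over g -> autf_over (f \o g)
| autf_inv f g : autf_over f -> cancel f g -> cancel g f -> autf_over g.

Definition lascar_equiv (I : Type) (X Y : set (I -> M)) : Prop :=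
  exists2 f, autf_over f & hyp_act f X = Y.

Definition indiscernible (I : Type) (F : (I -> M) -> (I -> M) -> Prop)
    (s : nat -> I -> M) : Prop :=
  forall (n : nat) (t : 'I_n.+1 -> nat), {homo t : i j / (i < j)%N} ->
  exists2 f, aut_over f &
    forall k : 'I_n.+1, hyp_act f (hyp F (s k)) = hyp F (s (t k)).

Definition lascar_dist_le (I : Type) (F : (I -> M) -> (I -> M) -> Prop)
    (c d : I -> M) (n : nat) : Prop :=
  exists u : nat -> I -> M,
    [/\ hyp F (u 0) = hyp F c, hyp F (u n) = hyp F d
      & forall i, (i < n)%N -> exists s : nat -> I -> M,
          [/\ indiscernible F s, hyp F (s 0) = hyp F (u i)
            & hyp F (s 1) = hyp F (u i.+1)]].

Definition lascar_dist (I : Type) (F : (I -> M) -> (I -> M) -> Prop)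
    (c d : I -> M) (n : nat) : Prop :=
  lascar_dist_le F c d n /\ forall m, lascar_dist_le F c d m -> (n <= m)%N.

(* [n] is the maximum of the distances from [c]; the second clause asks for the
   bound, not only for those [d] that have a distance. *)
Definition lascar_diameter (I : Type) (F : (I -> M) -> (I -> M) -> Prop)
    (c : I -> M) (n : nat) : Prop :=
  (exists2 d, lascar_equiv (hyp F c) (hyp F d) & lascar_dist F c d n) /\
  forall d, lascar_equiv (hyp F c) (hyp F d) ->
    exists2 m, lascar_dist F c d m & (m <= n)%N.

Definition finite_lascar_diameter (I : Type)
    (F : (I -> M) -> (I -> M) -> Prop) (c : I -> M) : Prop :=
  exists n, lascar_diameter F c n.

End Over.

(* Main.v *)
Require Import Defs.
From mathcomp Require Import filter zify.

(** Let [G] be the group of Lascar strong automorphisms over [e], and let [X] be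
    the set of the real tuples whose class has the Lascar strong type of that of
    [b]. Then [G] acts on [X], and the assumption says that [X] is closed, that
    is, type-definable over a small set.

    Distances are controlled through a relation between real tuples which is
    type-definable over [a]: [x] and [y] are [adjacent] if they are the first
    two terms of a sequence of real tuples that is indiscernible over some
    representative of [e]. By a compactness argument ([indisc_swap]) the
    sequence can be reversed at its first two terms, so adjacent tuples have
    distance at most 1 in both directions. On the other hand, if [f] fixes a
    model over which [e] is definable, then [x] and [f x] have a common
    neighbour ([adjacent2_fixed_model]): a Morley sequence, over the model, [x]
    and [f x], of a global coheir of the type of [x] over the model continues
    both [x] and [f x] to an indiscernible sequence. Hence [X] is the union of
    countably many sets [reach n], each type-definable over [a] and [b], and
    consisting of points at distance at most [2 * n] from [b].

    The rest is topological dynamics. The space of ultrafilters on [X] is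
    compact, and [G] acts on it; take a minimal nonempty closed invariant subset
    [Y], represented here by a maximal [G]-invariant proper filter
    ([max_invariant_filter]). The sets [reach n] give closed sets covering [Y],
    so by Baire's argument one of them contains the nonempty trace on [Y] of an
    open set [S] ([reach_somewhere_dense]), and by minimality finitely many
    translates of [S] cover [Y] ([max_invariant_cover]). Let [h] be in [G]. Since
    [h Y = Y], an ultrafilter in [Y] lies in one of these translates and its
    image under [h] in another one. This gives a point [c], and elements [g1] and
    [g2] of a finite subset of [G] that does not depend on [h], such that [g1 c]
    and [g2 (h c)] are in [reach n]. So [c] is near the image of [b] under the
    inverse of [g1], hence near [b], and likewise near the image of [b] under the
    inverse of [h], with bounds that do not depend on [h] ([lstp_bounded]). As
    these images exhaust [X] up to [F], all distances from [b] are bounded. *)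

Set Implicit Arguments.
Unset Strict Implicit.
Unset Printing Implicit Defensive.

Local Open Scope classical_set_scope.
Local Open Scope card_scope.

(** * Small cardinals *)

Lemma card_le_setTP U V :
  ([set: U] #<= [set: V]) <-> exists f : U -> V, injective f.
Proof.
split=> [/card_leP[f]|[f injf]].
  pose g (u : U) : V := val (f (to_setT u)).
  exists g => u v /val_inj fuv.
  have /(congr1 val) := 'inj_f (in_setT (to_setT u)) (in_setT (to_setT v)) fuv.
  by [].
have /Pinj[g _] : {in [set: U] &, injective f} by move=> u v _ _; apply: injf.
by apply: inj_card_le; exact: 'totalfun_[set: U] g.
Qed.

Lemma card_le_total U V : [set: U] #<= [set: V] \/ [set: V] #<= [set: U].
Proof.
pose pinj (G : set (U * V)) := forall p q, G p -> G q ->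
  (p.1 = q.1 <-> p.2 = q.2).
have [G [Ginj Gmax]] : exists G, pinj G /\ forall H, G `<` H -> ~ pinj H.
  apply: Zorn_bigcup => F Finj Ftot p q [A FA Ap] [B FB Bq].
  have [AB|BA] := Ftot _ _ FA FB.
    by apply: (Finj _ FB) => //; apply: AB.
  by apply: (Finj _ FA) => //; apply: BA.
have [Gdom|/existsNP[u uG]] := pselect (forall u, exists v, G (u, v)).
  left; have [f Gf] := choice Gdom; apply/card_le_setTP; exists f => u v.
  by move/(Ginj (u, f u) (v, f v) (Gf u) (Gf v)).
have [Gcod|/existsNP[v vG]] := pselect (forall v, exists u, G (u, v)).
  right; have [f Gf] := choice Gcod; apply/card_le_setTP; exists f => v w.
  by move/(Ginj (f v, v) (f w, w) (Gf v) (Gf w)).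
exfalso; apply: (Gmax (G `|` [set (u, v)])).
  split=> [|sub]; first by move=> p; left.
  by apply: uG; exists v; apply: sub; right.
move=> p q [Gp|->] [Gq|->] //=; first exact: Ginj.
- split=> E; first by case: uG; exists p.2; rewrite -E; case: p Gp {E}.
  by case: vG; exists p.1; rewrite -E; case: p Gp {E}.
- split=> E; first by case: uG; exists q.2; rewrite E; case: q Gq {E}.
  by case: vG; exists q.1; rewrite E; case: q Gq {E}.
Qed.

(** A maximal partial bijection from [nat * B] onto [B] misses only finitely
    many points of [V], since it could be extended by a bijection between
    [nat * C] and [C] for any countable [C] that it misses. *)
Lemma card_nat_mul V : [set: nat] #<= [set: V] ->
  [set: nat * V] #<= [set: V].
Proof.
move=> Vinf.
pose bijs (G : set ((nat * V) * V)) := (forall p q, G p -> G q ->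
  (p.1 = q.1 <-> p.2 = q.2)) /\
  forall p, G p -> (forall n, exists v, G ((n, p.1.2), v)) /\
                   (forall n, exists v, G ((n, p.2), v)) /\
                   exists nv, G (nv, p.1.2).
have [G [[Ginj Gcl] Gmax]] : exists G, bijs G /\ forall H, G `<` H -> ~ bijs H.
  apply: Zorn_bigcup => F Fbij Ftot; split.
    move=> p q [A FA Ap] [B FB Bq].
    have [AB|BA] := Ftot _ _ FA FB.
      by apply: (Fbij _ FB).1 => //; apply: AB.
    by apply: (Fbij _ FA).1 => //; apply: BA.
  move=> p [A FA /((Fbij _ FA).2)[d1 [d2 [w d3]]]]; split; [|split].
  - by move=> n; have [v ?] := d1 n; exists v, A.
  - by move=> n; have [v ?] := d2 n; exists v, A.
  - by exists w, A.
pose B v := exists nv, G (nv, v).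
have Bdom n v : B v -> exists w, G ((n, v), w).
  by case=> nv /Gcl [_ [/(_ n)]].
have domB n v w : G ((n, v), w) -> B v by move=> /Gcl [_ [_]].
have fin : finite_set (~` B).
  apply: contrapT => /infiniteP.
  rewrite -(card_le_eqr (card_setT _)) => /card_le_setTP[c cinj].
  pose f (n : nat) : V := val (c n).
  have fB n : ~ B (f n) by have /set_mem := valP (c n).
  have finj : injective f by move=> i j /val_inj/cinj.
  have [gg [ginj' gsurj]] : exists gg : nat * nat -> nat,
      injective gg /\ forall n, exists p, gg p = n.
    have /card_set_bijP[gg [_ gi gs]] := card_nat2; exists gg; split.
      by move=> p q; apply: gi; rewrite in_setT.
    by move=> n; have [p _ ?] := gs n I; exists p.
  pose H := [set x | exists n m, x = ((n, f m), f (gg (n, m)))].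
  apply: (Gmax (G `|` H)).
    split=> [|sub]; first by move=> p; left.
    have : G ((0, f 0), f (gg (0, 0))) by apply: sub; right; exists 0, 0.
    by move/domB/fB.
  split.
    move=> p q [Gp|[n [m ->]]] [Gq|[n' [m' ->]]] /=.
    - exact: Ginj.
    - split=> E.
        by case: (fB m'); apply: (domB n' _ p.2); rewrite -E; case: p Gp {E}.
      by case: (fB (gg (n', m'))); exists p.1; rewrite -E; case: p Gp {E}.
    - split=> E.
        by case: (fB m); apply: (domB n _ q.2); rewrite E; case: q Gq {E}.
      by case: (fB (gg (n, m))); exists q.1; rewrite E; case: q Gq {E}.
    - split=> [[-> /finj ->]//|/finj/ginj'[-> ->]//].
  move=> p [/Gcl[d1 [d2 [w d3]]]|[n [m ->]]].
    split; [|split].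
    - by move=> n; have [v ?] := d1 n; exists v; left.
    - by move=> n; have [v ?] := d2 n; exists v; left.
    - by exists w; left.
  split; [|split] => /=.
  - by move=> k; exists (f (gg (k, m))); right; exists k, m.
  - by move=> k; exists (f (gg (k, gg (n, m)))); right; exists k, (gg (n, m)).
  - have [[k l] kl] := gsurj m.
    by exists (k, f l); right; exists k, l; rewrite kl.
have /card_le_setTP[c cinj] := Vinf.
have [b0 b0B] : exists b0, B b0.
  apply: contrapT => nB; apply: infinite_nat.
  apply: card_le_finite Vinf _; suff -> : [set: V] = ~` B by [].
  by apply/seteqP; split=> v // _ Bv; apply: nB; exists v.
have [e einj] : exists e : V -> nat, {in ~` B &, injective e}.
  have := finite_set_countable fin.
  rewrite /countable -(card_le_eql (card_setT _)) => /card_le_setTP[e einj].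
  have [e' e'P] : exists e' : V -> nat,
      forall v (Bv : v \in ~` B), e' v = e (exist _ v Bv).
    have /choice[e' e'P] : forall v, exists n : nat,
        forall Bv : v \in ~` B, n = e (exist _ v Bv).
      move=> v; have [Bv|nBv] := pselect (v \in ~` B); last by exists 0.
      by exists (e (exist _ v Bv)) => Bv'; rewrite (bool_irrelevance Bv Bv').
    by exists e'.
  exists e' => u v Bu Bv.
  by rewrite (e'P u Bu) (e'P v Bv) => /einj/(congr1 sval).
have := card_nat2; rewrite card_eq_le => /andP[/card_le_setTP[p2 p2inj] _].
(* [nat * V] embeds in [nat * (nat * B)], the points outside [B] being coded
   by the pairs with second component [b0] *)
pose code v : nat * V := if pselect (B v) is left _ then (0, v)
                         else ((e v).+1, b0).
have codeB v : B (code v).2 by rewrite /code; case: pselect.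
have codeinj : injective code.
  move=> u v; rewrite /code; case: pselect => Bu; case: pselect => Bv //.
    by case.
  by case=> /einj E; apply: E; apply: mem_set.
pose arg (x : nat * V) : nat * V := (p2 (x.1, (code x.2).1), (code x.2).2).
have arginj : injective arg.
  move=> [n u] [m v] [/p2inj[-> E1] E2]; congr (_, _); apply: codeinj.
  by rewrite [code u]surjective_pairing [code v]surjective_pairing E1 E2.
have /choice[h hG] : forall x, exists w, G (arg x, w).
  by move=> x; apply: Bdom; apply: codeB.
apply/card_le_setTP; exists h => x y hxy; apply: arginj.
by apply/(Ginj (arg x, h x) (arg y, h y) (hG x) (hG y)).
Qed.

Section Small.
Variable (K : Type).
Hypothesis Knat : small K [set: nat].

Lemma small_le U V (A : set U) (B : set V) :
  A #<= B -> small K B -> small K A.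
Proof. by move=> AB sB KA; apply: sB; apply: card_le_trans KA AB. Qed.

Lemma small_range U V (f : U -> V) : small K [set: U] -> small K (range f).
Proof. exact/small_le/card_image_le. Qed.

Lemma small_nat_mul V : small K [set: V] -> small K [set: nat * V].
Proof.
have [/card_nat_mul le sV|fin _] := pselect ([set: nat] #<= [set: V]).
  exact: small_le le sV.
have {}fin : finite_set [set: V] by apply/finite_setPn.
have cV : countable [set: nat * V].
  rewrite -setXTT; apply: countableX => //; exact: finite_set_countable.
exact: small_le cV Knat.
Qed.

Lemma small_add U V : small K [set: U] -> small K [set: V] ->
  small K [set: U + V].
Proof.
have addle (W X : Type) : [set: W] #<= [set: X] ->
    [set: W + X] #<= [set: nat * X] /\ [set: X + W] #<= [set: nat * X].
  move=> /card_le_setTP[f finj]; split; apply/card_le_setTP.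
    exists (fun x => match x with inl w => (0, f w) | inr y => (1, y) end).
    by move=> [w|y] [w'|y'] //= [] => [/finj|] ->.
  exists (fun x => match x with inr w => (0, f w) | inl y => (1, y) end).
  by move=> [w|y] [w'|y'] //= [] => [|/finj] ->.
move=> sU sV; have [le|le] := card_le_total U V.
  exact: small_le (addle _ _ le).1 (small_nat_mul sV).
exact: small_le (addle _ _ le).2 (small_nat_mul sU).
Qed.

End Small.

(** * Formulas: renaming, free variables, automorphisms *)

Definition glue (X V P : Type) (v : V -> X) (w : P -> X) (x : V + P) : X :=
  match x with inl y => v y | inr p => w p end.

Notation "v +:+ w" := (glue v w) (at level 50, left associativity).

Lemma comp_glue (X Y V P : Type) (f : X -> Y) (v : V -> X) (w : P -> X) :
  f \o (v +:+ w) = (f \o v) +:+ (f \o w).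
Proof. by apply/funext => -[]. Qed.

Section Formulas.
Variable L : language.

Definition FNot V (phi : formula L V) := FImp phi (FBot L V).
Definition FTrue V := FNot (FBot L V).
Definition FAnd V (phi psi : formula L V) := FNot (FImp phi (FNot psi)).
Definition FEx V (phi : formula L (option V)) := FNot (FAll (FNot phi)).

Fixpoint trename (V W : Type) (f : V -> W) (t : term L V) : term L W :=
  match t with
  | Var x => Var L (f x)
  | App g ts => App (fun i => trename f (ts i))
  end.

Fixpoint rename (V : Type) (phi : formula L V) :
    forall W : Type, (V -> W) -> formula L W :=
  match phi with
  | FBot => fun W f => FBot L W
  | FEq s t => fun W f => FEq (trename f s) (trename f t)
  | FRel r ts => fun W f => FRel (fun i => trename f (ts i))
  | FImp phi1 phi2 => fun W f => FImp (rename phi1 f) (rename phi2 f)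
  | FAll phi1 => fun W f => FAll (rename phi1 (omap f))
  end.

Fixpoint tfv (V : Type) (t : term L V) : set V :=
  match t with
  | Var x => [set x]
  | App g ts => \bigcup_i tfv (ts i)
  end.

Fixpoint fv (V : Type) (phi : formula L V) : set V :=
  match phi with
  | FBot => set0
  | FEq s t => tfv s `|` tfv t
  | FRel r ts => \bigcup_i tfv (ts i)
  | FImp phi1 phi2 => fv phi1 `|` fv phi2
  | FAll phi1 => [set x | fv phi1 (Some x)]
  end.

Lemma tfv_trename V W (f : V -> W) (t : term L V) :
  tfv (trename f t) `<=` f @` tfv t.
Proof.
elim: t => [x|g ts IH] y /=; first by move=> ->; exists x.
by move=> [i _ /IH[x xt <-]]; exists x => //; exists i.
Qed.

Lemma fv_rename V (phi : formula L V) W (f : V -> W) :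
  fv (rename phi f) `<=` f @` fv phi.
Proof.
elim: phi W f => {V} [V|V s t|V r ts|V p1 IH1 p2 IH2|V p IH] W f /= y.
- by [].
- by move=> [] H; have [x xt <-] := tfv_trename H; exists x => //; [left|right].
- by move=> [i _ H]; have [x xt <-] := tfv_trename H; exists x => //; exists i.
- move=> [] H; [have [x xt <-] := IH1 _ _ _ H|have [x xt <-] := IH2 _ _ _ H].
    by exists x => //; left.
  by exists x => //; right.
- by move=> H; have [[x|] //= xt [<-]] := IH _ _ _ H; exists x.
Qed.

Lemma tfv_finite V (t : term L V) : finite_set (tfv t).
Proof.
elim: t => [x|g ts IH] /=; first exact: finite_set1.
by apply: bigcup_finite => //; exact: finite_finset.
Qed.

Lemma fv_finite V (phi : formula L V) : finite_set (fv phi).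
Proof.
elim: phi => {V} [V|V s t|V r ts|V p1 IH1 p2 IH2|V p IH] /=.
- exact: finite_set0.
- by rewrite finite_setU; split; exact: tfv_finite.
- by apply: bigcup_finite => [|i _]; [exact: finite_finset|exact: tfv_finite].
- by rewrite finite_setU; split.
- apply: card_le_finite IH; rewrite -(card_le_eql (card_some)).
  by apply: subset_card_le => _ [x xp <-].
Qed.

Section Sat.
Variable M : structure L.

Lemma teval_trename V W (f : V -> W) (t : term L V) (v : W -> M) :
  teval v (trename f t) = teval (v \o f) t.
Proof.
by elim: t => [x|g ts IH] //=; congr func_int; apply/funext => i; exact: IH.
Qed.

Lemma sat_rename V (phi : formula L V) W (f : V -> W) (v : W -> M) :
  sat (rename phi f) v <-> sat phi (v \o f).
Proof.
elim: phi W f v => {V} [V|V s t|V r ts|V p1 IH1 p2 IH2|V p IH] W f v //=.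
- by rewrite !teval_trename.
- by under eq_fun do rewrite teval_trename.
- by rewrite IH1 IH2.
- split=> H m.
    have /IH := H m; congr (sat p _); apply/funext => -[x|] //=.
  by apply/IH; move: (H m); congr (sat p _); apply/funext => -[x|].
Qed.

Lemma teval_tfv V (t : term L V) (v w : V -> M) :
  (forall x, tfv t x -> v x = w x) -> teval v t = teval w t.
Proof.
elim: t => [x|g ts IH] /= vw; first exact: vw.
by congr func_int; apply/funext => i; apply: IH => x xt; apply: vw; exists i.
Qed.

Lemma sat_fv V (phi : formula L V) (v w : V -> M) :
  (forall x, fv phi x -> v x = w x) -> sat phi v <-> sat phi w.
Proof.
elim: phi v w => {V} [V|V s t|V r ts|V p1 IH1 p2 IH2|V p IH] v w //= vw.
- rewrite (@teval_tfv _ s v w) 1?(@teval_tfv _ t v w) // => x xt; apply: vw.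
    by right.
  by left.
- suff -> : (fun i => teval v (ts i)) = (fun i => teval w (ts i)) by [].
  by apply/funext => i; apply: teval_tfv => x xt; apply: vw; exists i.
- by rewrite (IH1 v w) 1?(IH2 v w) // => x xt; apply: vw; [right|left].
- by split=> H m; apply/(IH (extend v m) (extend w m)) => // -[x|] //=; apply: vw.
Qed.

Lemma sat_true V (v : V -> M) : sat (FTrue V) v.
Proof. by move=> []. Qed.

Lemma sat_and V (phi psi : formula L V) (v : V -> M) :
  sat (FAnd phi psi) v <-> sat phi v /\ sat psi v.
Proof.
split=> /= [H|[H1 H2]]; last by apply.
by split; apply: contrapT => H'; apply: H => ? ?; apply: H'.
Qed.

Lemma sat_ex V (phi : formula L (option V)) (v : V -> M) :
  sat (FEx phi) v <-> exists m, sat phi (extend v m).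
Proof.
split=> /= [H|[m H]]; last by move/(_ m); apply.
by apply: contrapT => H'; apply: H => m Hm; apply: H'; exists m.
Qed.

Lemma same_type_sub V (c d : V -> M) :
  (forall phi : formula L V, sat phi c -> sat phi d) -> same_type c d.
Proof.
move=> cd phi; split; first exact: cd.
by move=> pd; apply: contrapT => npc; have := cd (FNot phi) npc; apply.
Qed.

Lemma aut_teval f V (t : term L V) (v : V -> M) : automorphism f ->
  teval (f \o v) t = f (teval v t).
Proof.
move=> [_ fF _]; elim: t => [x|g ts IH] //=.
by rewrite fF; congr func_int; apply/funext => i /=.
Qed.

Lemma aut_sat f V (phi : formula L V) (v : V -> M) : automorphism f ->
  sat phi (f \o v) <-> sat phi v.
Proof.
move=> autf; have [[g fK gK] _ fR] := autf.
elim: phi v => {V} [V|V s t|V r ts|V p1 IH1 p2 IH2|V p IH] v //=.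
- by rewrite !aut_teval //; split=> [/(can_inj fK)|->].
- have -> : (fun i => teval (f \o v) (ts i)) = f \o (fun i => teval v (ts i)).
    by apply/funext => i /=; rewrite aut_teval.
  by rewrite -fR.
- by rewrite IH1 IH2.
- split=> H m.
    apply/IH; move: (H (f m)); congr (sat p _).
    by apply/funext => -[x|].
  move/IH: (H (g m)); congr (sat p _).
  by apply/funext => -[x|] //=; rewrite gK.
Qed.

Lemma aut_id : automorphism (@id M).
Proof. by split => //; exists id. Qed.

Lemma aut_comp (f g : M -> M) :
  automorphism f -> automorphism g -> automorphism (f \o g).
Proof.
move=> [bf fF fR] [bg gF gR]; split; first exact: bij_comp.
  by move=> h ms; rewrite /= gF fF.
by move=> r ms; rewrite gR fR.
Qed.

Lemma aut_inv (f g : M -> M) : automorphism f -> cancel f g -> cancel g f ->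
  automorphism g.
Proof.
move=> [bf fF fR] fK gK; split; first by exists f.
  move=> h ms; rewrite -[RHS]fK fF; congr (g (func_int _)).
  by apply/funext => i /=; rewrite gK.
move=> r ms; rewrite (fR r (g \o ms)); suff -> : f \o (g \o ms) = ms by [].
by apply/funext => i /=; rewrite gK.
Qed.

End Sat.
End Formulas.

(** * Compactness for small tuples of variables *)

Lemma finite_set_ind U (Q : set U -> Prop) :
  Q set0 -> (forall x A, Q A -> Q (x |` A)) -> forall A, finite_set A -> Q A.
Proof.
elim/Pchoice: U Q => U Q Q0 QS A /finite_seqP[s ->] {A}.
elim: s => [|x s IH].
  by suff -> : [set` [::]] = set0 :> set U by []; apply/seteqP; split.
suff -> : [set` x :: s] = x |` [set` s] by exact: QS.
apply/seteqP; split=> y /=; rewrite inE; first by case/orP=> [/eqP|]; [left|right].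
by move=> [->|]; rewrite ?eqxx // => ->; rewrite orbT.
Qed.

Lemma finite_chain U (F : set (set U)) : F !=set0 -> total_on F subset ->
  forall B, finite_set B -> B `<=` \bigcup_(X in F) X ->
  exists2 X, F X & B `<=` X.
Proof.
move=> [X0 FX0] Ftot; apply: finite_set_ind; first by exists X0.
move=> x B IH sub.
have [|X FX BX] := IH; first by move=> y By; apply: sub; right.
have [|Y FY Yx] := sub x; first by left.
have [XY|YX] := Ftot _ _ FX FY.
  by exists Y => // y [->//|/BX/XY].
by exists X => // y [->|/BX//]; apply: YX.
Qed.

Definition upd V X (z : V) (c : V -> X) (m : X) (v : V) : X :=
  if pselect (v = z) then m else c v.

Lemma upd_same V X z (c : V -> X) m : upd z c m z = m.
Proof. by rewrite /upd; case: pselect. Qed.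

Lemma upd_other V X z (c : V -> X) m v : v <> z -> upd z c m v = c v.
Proof. by rewrite /upd; case: pselect. Qed.

Lemma upd_id V X z (c : V -> X) : upd z c (c z) = c.
Proof. by apply/funext => v; rewrite /upd; case: pselect => /= vz; rewrite ?vz. Qed.

Lemma upd_glue V P X z (c : V -> X) (io : P -> X) m :
  upd (inl z) (c +:+ io) m = upd z c m +:+ io.
Proof.
apply/funext => -[v|p]; last by rewrite upd_other.
have [->|vz] := pselect (v = z); first by rewrite /= !upd_same.
by rewrite /= !upd_other //; case.
Qed.

Section ExVar.
Variable L : language.

Definition hide_var V (z x : V) : option V :=
  if pselect (x = z) then None else Some x.

(** [z] stays a name for a variable, on which the formula no longer depends. *)
Definition FExVar V (z : V) (phi : formula L V) := FEx (rename phi (hide_var z)).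

Lemma fv_ExVar V z (phi : formula L V) x :
  fv (FExVar z phi) x -> fv phi x /\ x <> z.
Proof.
move=> [[|//]|//] H; have [y yp] := fv_rename H.
by rewrite /hide_var; case: pselect => // + [<-].
Qed.

Lemma sat_ExVar (M : structure L) V z (phi : formula L V) (v : V -> M) :
  sat (FExVar z phi) v <-> exists m, sat phi (upd z v m).
Proof.
rewrite sat_ex; suff E m : extend v m \o hide_var z = upd z v m.
  by split=> -[m]; [rewrite sat_rename E|rewrite -E -sat_rename] => H; exists m.
by apply/funext => x /=; rewrite /hide_var /upd; case: pselect.
Qed.

End ExVar.

Section Compactness.
Variables (K : Type) (L : language) (M : structure L).
Hypotheses (Knat : small K [set: nat]) (Msat : saturated K M).

Section Realize.
Variables (V P : Type) (io : P -> M).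
Hypotheses (sV : small K [set: V]) (sP : small K [set: P]).
Variables (U : set_system (V -> M)).
Hypothesis ultraU : UltraFilter U.

Let inU (phi : formula L (V + P)) := U [set v | sat phi (v +:+ io)].

Let over (S : set V) (phi : formula L (V + P)) := forall x, fv phi (inl x) -> S x.

Let good (S : set V) (c : V -> M) :=
  forall phi, over S phi -> inU phi -> sat phi (c +:+ io).

(** The values of [c] become parameters, so that saturation in one variable
    suffices to choose a value at [z]. *)
Lemma extend_good S c z : good S c -> ~ S z ->
  exists m, good (S `|` [set z]) (upd z c m).
Proof.
move=> gS Sz; pose B := range (c +:+ io).
have sB : small K B by apply: small_range; exact: small_add.
pose par (x : V + P) : B := SigSub (mem_set (ex_intro2 _ _ x I erefl)).
pose rho (x : V + P) : unit + B :=
  if pselect (x = inl z) then inl tt else inr (par x).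
have rhoE (u : unit -> M) : with_params u \o rho = upd z c (u tt) +:+ io.
  apply/funext => x /=; rewrite /rho; case: pselect => xz /=.
    by rewrite xz /= upd_same.
  by case: x xz => [v|p] //= vz; rewrite upd_other // => vz'; apply: vz; rewrite vz'.
pose S' := S `|` [set z].
pose p : partial_type B unit :=
  [set rename phi rho | phi in [set phi | over S' phi /\ inU phi]].
have [|u up] := Msat sB (p := p); last first.
  exists (u tt) => phi oS Uphi; rewrite -rhoE -sat_rename.
  by apply: up; exists phi.
(* the conjunction of finitely many members of the ultrafilter type is again
   a member, and so is its existential quantification over [z] *)
move=> q fq qp.
have [phi [[oS Uphi] phiq]] : exists phi, (over S' phi /\ inU phi) /\
    forall m, sat phi (upd z c m +:+ io) ->
    realizes (fun _ : unit => m) q.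
  move: q fq qp; apply: finite_set_ind => [_|psi q IH qp].
    exists (FTrue L _); split=> [|m _ psi //].
    by split=> [x [[]|[]]|]; apply: filterS (@filterT _ U _) => v _; exact: sat_true.
  have [phi [[oS Uphi] phiq]] := IH (fun x qx => qp x (or_intror qx)).
  have [phi' [oS' Uphi'] psiE] : p psi by apply: qp; left.
  exists (FAnd phi phi'); split.
    split=> [x [[H|[H|[]]]|[]]|]; [exact: oS|exact: oS'|].
    apply: filterS (filterI Uphi Uphi') => v /= [H1 H2].
    exact/sat_and.
  move=> m /sat_and[H1 H2] chi [->|]; last exact: phiq.
  by rewrite -psiE sat_rename rhoE.
have : sat (FExVar (inl z) phi) (c +:+ io).
  apply: gS.
    move=> x H; have [xphi xz] := fv_ExVar H.
    by case: (oS _ xphi) => [//|/= xz']; rewrite xz' in xz.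
  apply: filterS Uphi => v /= H; apply/sat_ExVar; exists (v z).
  by rewrite upd_glue upd_id.
by move=> /sat_ExVar[m]; rewrite upd_glue => H; exists (fun _ => m); exact: phiq.
Qed.

(** Partial realizations are encoded as graphs, so that Zorn's lemma for
    inclusion applies. *)
Lemma ultra_realized : exists c, forall phi, inU phi -> sat phi (c +:+ io).
Proof.
pose dom (G : set (V * M)) := [set x | exists m, G (x, m)].
pose ext (G : set (V * M)) (c : V -> M) := forall x m, G (x, m) -> c x = m.
pose ok G := (forall x m m', G (x, m) -> G (x, m') -> m = m') /\
  forall c, ext G c -> good (dom G) c.
have [m0] := carrier_inh M.
have ok0 : ok set0.
  split=> // c _ phi o Uphi; have [v] := filter_ex Uphi.
  by rewrite /=; apply: (sat_fv _).1 => -[x /o[//]|x].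
have [G [[Gfun Ggood] Gmax]] : exists G, ok G /\ forall H, G `<` H -> ~ ok H.
  apply: Zorn_bigcup => F0 F0ok F0tot.
  pose F := set0 |` F0.
  have Fok : F `<=` ok by move=> X [->|/F0ok].
  have Ftot : total_on F subset.
    by move=> X Y [->|FX] [->|FY]; [left|left|right|exact: F0tot].
  have -> : \bigcup_(X in F0) X = \bigcup_(X in F) X.
    apply/seteqP; split=> x [X FX Xx]; first by exists X => //; right.
    by case: FX Xx => [->//|FX Xx]; exists X.
  split=> [x m m' [X FX Xx] [Y FY Yx]|c cext phi o Uphi].
    have [XY|YX] := Ftot _ _ FX FY.
      by apply: (Fok _ FY).1 (XY _ Xx) Yx.
    by apply: (Fok _ FX).1 Xx (YX _ Yx).
  pose D := [set x | fv phi (inl x)].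
  have fD : finite_set [set (x, c x) | x in D].
    apply: finite_image; apply: card_le_finite (fv_finite phi).
    have inlinj : {in D &, injective (@inl V P)} by move=> x y _ _ [].
    rewrite -(card_le_eql (inj_card_eq inlinj)).
    by apply: subset_card_le => _ [x xD <-].
  have [||X FX DX] := finite_chain _ Ftot fD; first by exists set0; left.
    move=> _ [x /o[m Fx] <-]; have := cext _ _ Fx.
    by move=> ->.
  apply: (Fok _ FX).2 Uphi => [x m Xm|x xphi]; first by apply: cext; exists X.
  by exists (c x); apply: DX; exists x.
have /choice[c cG] : forall x, exists m, forall m', G (x, m') -> m = m'.
  move=> x; have [[m Gm]|nG] := pselect (dom G x).
    by exists m => m'; exact: Gfun.
  by exists m0 => m' Gm'; case: nG; exists m'.
have gc : good (dom G) c by exact: Ggood.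
exists c => phi; apply: (gc) => z _; apply: contrapT => nz.
have [m gm] := extend_good gc nz.
apply: (Gmax (G `|` [set (z, m)])).
  split=> [|sub]; first by move=> x; left.
  by apply: nz; exists m; apply: sub; right.
split.
  move=> x m1 m2 [G1|[-> ->]] [G2|]; first exact: Gfun G1 G2.
  - by move=> [xz _]; case: nz; exists m1; rewrite -xz.
  - by case: nz; exists m2.
  - by move=> [->].
move=> d dext psi o Upsi; apply/(sat_fv (w := upd z c m +:+ io)).
  move=> [x|//] xpsi /=; have [->|xz] := pselect (x = z).
    by rewrite upd_same; apply: dext; right.
  rewrite upd_other //; have [m' [Gm'|[/xz//]]] := o _ xpsi.
  by rewrite (cG _ _ Gm') (dext x m') //; left.
apply: gm => // x /o[m' [Gm'|[->]]]; last by right.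
by left; exists m'.
Qed.

End Realize.

(** Filters play the role of finitely satisfiable types: the assumption that
    finite conjunctions are satisfiable is the properness of the filter. *)
Lemma compactness V P (io : P -> M) (FF : set_system (V -> M)) :
  small K [set: V] -> small K [set: P] -> ProperFilter FF ->
  exists c, forall phi : formula L (V + P),
    FF [set v | sat phi (v +:+ io)] -> sat phi (c +:+ io).
Proof.
move=> sV sP /ultraFilterLemma[U [ultraU FU]].
have [c cU] := ultra_realized io sV sP ultraU.
by exists c => phi /FU; exact: cU.
Qed.

End Compactness.

(** * Sets that are type-definable over a small tuple *)

Section Closed.
Variables (L : language) (M : structure L) (P : Type) (io : P -> M).

(** The intersections of sets defined by formulas with parameters [io]: with
    this formulation, no partial type has to be named. *)
Definition closed_over V (D : set (V -> M)) := forall v,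
  (forall phi : formula L (V + P),
     (forall u, D u -> sat phi (u +:+ io)) -> sat phi (v +:+ io)) -> D v.

Lemma closed_ext V (D D' : set (V -> M)) :
  (forall v, D v <-> D' v) -> closed_over D -> closed_over D'.
Proof.
move=> DD' cD v H; apply/DD'/cD => phi phiD.
by apply: H => u /DD'; exact: phiD.
Qed.

Lemma closed_forall V T (D : T -> set (V -> M)) :
  (forall i, closed_over (D i)) -> closed_over [set v | forall i, D i v].
Proof.
by move=> cD v H i; apply: cD => phi phiD; apply: H => u /(_ i)/phiD.
Qed.

Lemma closed_and V (D1 D2 : set (V -> M)) :
  closed_over D1 -> closed_over D2 -> closed_over [set v | D1 v /\ D2 v].
Proof.
move=> c1 c2 v H; split; [apply: c1|apply: c2] => phi phiD.
  by apply: H => u [/phiD].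
by apply: H => u [_ /phiD].
Qed.

Lemma closed_sat V W (phi : formula L W) (g : W -> V + P) :
  closed_over [set v : V -> M | sat phi ((v +:+ io) \o g)].
Proof.
by move=> v H; apply/(sat_rename phi g)/H => u; rewrite sat_rename.
Qed.

Lemma closed_sat_iff V W (phi : formula L W) (g h : W -> V + P) :
  closed_over [set v : V -> M |
    sat phi ((v +:+ io) \o g) <-> sat phi ((v +:+ io) \o h)].
Proof.
move=> v H.
have H1 : sat (FAnd (FImp (rename phi g) (rename phi h))
                (FImp (rename phi h) (rename phi g))) (v +:+ io).
  by apply: H => u; rewrite sat_and /= !sat_rename => -[].
by move: H1; rewrite sat_and /= !sat_rename => -[].
Qed.

Lemma closed_eq V (x y : V + P) :
  closed_over [set v : V -> M | (v +:+ io) x = (v +:+ io) y].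
Proof. exact: (@closed_sat V (V + P) (FEq (Var L x) (Var L y)) id). Qed.

Lemma closed_preimage V W (g : W -> V + P) (D : set (W -> M)) :
  closed_over D -> closed_over [set v : V -> M | D ((v +:+ io) \o g)].
Proof.
move=> cD v H; apply: cD => phi phiD.
pose h (x : W + P) : V + P := match x with inl w => g w | inr p => inr p end.
have hE u : (u +:+ io) \o h = ((u +:+ io) \o g) +:+ io.
  by apply/funext => -[].
rewrite -hE -sat_rename; apply: H => u Du; rewrite sat_rename hE.
exact: phiD.
Qed.

Lemma closed_aut V (D : set (V -> M)) f v : closed_over D ->
  automorphism f -> f \o io = io -> D v -> D (f \o v).
Proof.
move=> cD autf fio Dv; apply: cD => phi phiD.
by rewrite -fio -comp_glue aut_sat //; exact: phiD.
Qed.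

End Closed.

Section Monster.
Variables (K : Type) (L : language) (M : structure L).
Hypotheses (Knat : small K [set: nat]) (Msat : saturated K M)
  (Mhom : strongly_homogeneous K M).

Lemma homogeneous V P (c d : V -> M) (w w' : P -> M) :
  small K [set: V] -> small K [set: P] ->
  same_type (c +:+ w) (d +:+ w') ->
  exists f, [/\ automorphism f, f \o c = d & f \o w = w'].
Proof.
move=> sV sP /(Mhom (small_add Knat sV sP))[f autf fE].
exists f; split=> //; apply/funext => x.
  by have /(congr1 (@^~ (inl x))) := fE.
by have /(congr1 (@^~ (inr x))) := fE.
Qed.

(** If [v] is in the closure of the projection, then its type over [io] is
    consistent with [D]. By compactness some point of [D] projects to a
    realization of this type, and homogeneity moves the projection to [v]. *)
Lemma closed_proj P (io : P -> M) V W (D : set (V + W -> M)) :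
  small K [set: V] -> small K [set: W] -> small K [set: P] ->
  closed_over io D -> closed_over io [set v | exists w, D (v +:+ w)].
Proof.
move=> sV sW sP cD v vD.
pose S phi := [set u | D u /\ sat phi ((u \o inl) +:+ io)].
pose FF : set_system (V + W -> M) := [set T | exists2 phi : formula L (V + P),
  sat phi (v +:+ io) & S phi `<=` T].
have FFP : ProperFilter FF.
  split.
    move=> [phi vphi Sphi]; suff : sat (FNot phi) (v +:+ io) by apply.
    apply: vD => u [w Duw] uphi; apply: (Sphi (u +:+ w)); split=> //.
  split.
  - by exists (FTrue L _); [exact: sat_true|].
  - move=> A B [phi vphi phiA] [psi vpsi psiB]; exists (FAnd phi psi).
      exact/sat_and.
    by move=> u [Du /sat_and[u1 u2]]; split; [exact: phiA|exact: psiB].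
  - move=> A B AB [phi vphi phiA]; exists phi => // u /phiA; exact: AB.
have [c cFF] := compactness Knat Msat io (small_add Knat sV sW) sP FFP.
have Dc : D c.
  apply: cD => phi phiD; apply: cFF; exists (FTrue L _); first exact: sat_true.
  by move=> u [Du _]; exact: phiD.
have [|f [autf fc fio]] := homogeneous (c := c \o inl) (d := v) (w := io)
    (w' := io) sV sP.
  suff /same_type_sub H : forall phi : formula L (V + P), sat phi (v +:+ io) ->
      sat phi ((c \o inl) +:+ io) by move=> phi; rewrite H.
  move=> phi vphi.
  pose g (x : V + P) : V + W + P :=
    match x with inl y => inl (inl y) | inr p => inr p end.
  have gE u : (u +:+ io) \o g = (u \o inl) +:+ io by apply/funext => -[].
  rewrite -gE -sat_rename; apply: cFF; exists phi => // u [Du uphi].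
  by rewrite /= sat_rename gE.
exists (f \o (c \o inr)); have := closed_aut cD autf fio Dc.
by congr (D _); apply/funext => -[x|//]; rewrite -fc.
Qed.

End Monster.

(** * Indiscernible sequences of real tuples *)

Definition seqv (X I : Type) (s : nat -> I -> X) (p : nat * I) : X := s p.1 p.2.

Definition incr (t : nat -> nat) := {homo t : i j / (i < j)%N}.

Definition ext_incr n (t : nat -> nat) k := if k <= n then t k else t n + (k - n).

Lemma incr_ext n t : (forall i j, i < j <= n -> t i < t j) ->
  incr (ext_incr n t).
Proof.
move=> tn i j ij; rewrite /ext_incr.
have [jn|nj] := leqP j n; have [i_n|ni] := leqP i n; try lia.
  by apply: tn; lia.
suff : t i <= t n by lia.
have [->//|ni] := eqVneq i n; suff : t i < t n by lia.
by apply: tn; lia.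
Qed.

Definition below (L : language) (I P : Type) n (phi : formula L (nat * I + P)) :=
  forall k i, fv phi (inl (k, i)) -> k < n.

Lemma below_ex L I P (phi : formula L (nat * I + P)) : exists n, below n.+1 phi.
Proof.
pose D := [set k | exists i, fv phi (inl (k, i))].
have fD : finite_set D.
  pose h (x : nat * I + P) := if x is inl y then y.1 else 0.
  apply: sub_finite_set (finite_image h (fv_finite phi)).
  by move=> k [i ki]; exists (inl (k, i)).
suff [n nD] : exists n, forall k, D k -> k < n.+1.
  by exists n => k i ki; apply: nD; exists i.
elim/finite_set_ind: D / fD => [|k A [n nA]]; first by exists 0.
by exists (maxn k n) => m [->|/nA]; lia.
Qed.

Definition reindex (I P : Type) (f : nat -> nat) (x : nat * I + P) : nat * I + P :=
  match x with inl (k, i) => inl (f k, i) | inr p => inr p end.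

Lemma below_rename L I P n m (f : nat -> nat) (phi : formula L (nat * I + P)) :
  below n phi -> (forall k, k < n -> f k < m) ->
  below m (rename phi (reindex f)).
Proof.
move=> nphi fnm k i H.
by have [[[k' i']|//] /nphi k'n [<- _]] := fv_rename H; exact: fnm.
Qed.

Section Indisc.
Variables (L : language) (M : structure L).

Lemma below_sat I P n (phi : formula L (nat * I + P)) (s s' : nat -> I -> M)
    (w : P -> M) : below n phi -> (forall k, k < n -> s k = s' k) ->
  sat phi (seqv s +:+ w) <-> sat phi (seqv s' +:+ w).
Proof.
move=> nphi ss'; apply: sat_fv => -[[k i] /nphi kn|//].
by rewrite /= /seqv ss'.
Qed.

Lemma sat_rename_seq I P (f : nat -> nat) (phi : formula L (nat * I + P))
    (s : nat -> I -> M) (w : P -> M) :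
  sat (rename phi (reindex f)) (seqv s +:+ w) <->
  sat phi (seqv (s \o f) +:+ w).
Proof.
rewrite sat_rename; suff -> : (seqv s +:+ w) \o reindex f = seqv (s \o f) +:+ w.
  by [].
by apply/funext => -[[k i]|p].
Qed.

(** It is enough to compare the whole sequence with its subsequences, since
    a finite increasing tuple of indices extends to an increasing sequence. *)
Definition indisc I P (w : P -> M) (s : nat -> I -> M) :=
  forall t, incr t -> same_type (seqv (s \o t) +:+ w) (seqv s +:+ w).

Lemma aut_indisc I P (w : P -> M) (s : nat -> I -> M) f : automorphism f ->
  indisc w s -> indisc (f \o w) (fun k => f \o s k).
Proof.
move=> autf ind t /ind st phi.
have := st phi; rewrite -(aut_sat phi (seqv (s \o t) +:+ w) autf).
by rewrite -(aut_sat phi (seqv s +:+ w) autf) !comp_glue.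
Qed.

(** A decreasing tuple of indices is an increasing one read backwards. *)
Lemma indisc_rev I P (w : P -> M) (s : nat -> I -> M) m
    (phi : formula L (nat * I + P)) (u : nat -> nat) :
  indisc w s -> below m.+1 phi -> (forall i j, i < j <= m -> u j < u i) ->
  sat phi (seqv (s \o u) +:+ w) <-> sat phi (seqv (fun k => s (m - k)) +:+ w).
Proof.
move=> ind mphi dec.
pose t := ext_incr m (fun k => u (m - k)).
have tincr : incr t by apply: incr_ext => i j ij; apply: dec; lia.
have := ind t tincr (rename phi (reindex (subn m))).
rewrite !sat_rename_seq => <-; apply: below_sat mphi _ => k km /=.
by rewrite /t /ext_incr leq_subr subKn.
Qed.

End Indisc.

Section Reversal.
Variables (K : Type) (L : language) (M : structure L).
Hypotheses (Knat : small K [set: nat]) (Msat : saturated K M)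
  (Mhom : strongly_homogeneous K M).

(** By compactness the reversed finite initial segments have a limit, and it
    is indiscernible because its finite subsequences are reversed increasing
    subsequences of [s]. *)
Lemma indisc_swap I P (w : P -> M) (s : nat -> I -> M) :
  small K [set: I] -> small K [set: P] -> indisc w s ->
  exists r, [/\ indisc w r, r 0 = s 1 & r 1 = s 0].
Proof.
move=> sI sP ind; pose rev n k := s (n - k).
pose FF : set_system (nat * I -> M) :=
  [set T | exists n0, forall n, n0 <= n -> T (seqv (rev n))].
have FFP : ProperFilter FF.
  split; first by move=> [n /(_ n (leqnn n))].
  split.
  - by exists 0.
  - move=> A B [n nA] [m mB]; exists (maxn n m) => k; rewrite geq_max.
    by move=> /andP[/nA Ak /mB Bk].
  - by move=> A B AB [n nA]; exists n => k /nA/AB.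
have [r0 r0P] := compactness Knat Msat w (small_nat_mul Knat sI) sP FFP.
pose r k i := r0 (k, i).
have rr0 : seqv r = r0 by apply/funext => -[].
have satr (phi : formula L (nat * I + P)) m n : below m.+1 phi -> m <= n ->
    sat phi (seqv r +:+ w) <-> sat phi (seqv (rev n) +:+ w).
  have revE n' (psi : formula L (nat * I + P)) : below m.+1 psi -> m <= n' ->
      sat psi (seqv (rev n') +:+ w) <-> sat psi (seqv (rev m) +:+ w).
    move=> mpsi mn'; apply: (indisc_rev (u := fun k => n' - k) ind mpsi).
    by move=> i j; lia.
  move=> mphi mn; rewrite revE // rr0; split=> H; last first.
    by apply: r0P; exists m => n' mn'; apply/revE.
  apply: contrapT => nH; suff : sat (FNot phi) (r0 +:+ w) by apply.
  by apply: r0P; exists m => n' mn'; rewrite /= revE.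
have indr : indisc w r.
  move=> t tincr phi; have [m mphi] := below_ex phi.
  have tle k : k <= m -> t k <= t m.
    by rewrite leq_eqVlt => /orP[/eqP->//|/tincr/ltnW].
  rewrite -sat_rename_seq (@satr _ (t m) (t m)) //; last first.
    by apply: below_rename mphi _ => k; rewrite !ltnS; exact: tle.
  rewrite sat_rename_seq (indisc_rev (u := fun k => t m - t k) ind mphi).
    by rewrite (satr phi m m).
  by move=> i j /andP[ij jm]; have := tincr _ _ ij; have := tle _ jm; lia.
have [|f [autf fr fw]] := homogeneous Knat Mhom (c := r 0 +:+ r 1)
    (d := s 1 +:+ s 0) (w := w) (w' := w) (small_add Knat sI sI) sP.
  move=> psi.
  pose g (x : I + I + P) : nat * I + P := match x with
    | inl (inl i) => inl (0, i) | inl (inr i) => inl (1, i)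
    | inr p => inr p end.
  have gE (q : nat -> I -> M) : (seqv q +:+ w) \o g = (q 0 +:+ q 1) +:+ w.
    by apply/funext => -[[]|].
  rewrite -gE -sat_rename (@satr _ 1 1) //; last first.
    by move=> k i H; have [[[i'|i']|//] _ [<- _]] := fv_rename H.
  by rewrite sat_rename gE.
exists (fun k => f \o r k); split.
- by rewrite -fw; exact: aut_indisc.
- by apply/funext => i; have /(congr1 (@^~ (inl i))) := fr.
- by apply/funext => i; have /(congr1 (@^~ (inr i))) := fr.
Qed.

End Reversal.

(** * Hyperimaginaries and the Lascar distance *)

Lemma hyp_act_comp (M I : Type) (f g : M -> M) (X : set (I -> M)) :
  hyp_act (f \o g) X = hyp_act f (hyp_act g X).
Proof.
apply/seteqP; split=> [_ [c Xc <-]|_ [_ [c Xc <-] <-]]; last by exists c.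
by exists (g \o c) => //; exists c.
Qed.

Lemma hyp_act_id (M I : Type) (X : set (I -> M)) : hyp_act id X = X.
Proof. by apply/seteqP; split=> [_ [c Xc <-] //|c Xc]; exists c. Qed.

Lemma hyp_act_can (M I : Type) (f g : M -> M) (X : set (I -> M)) :
  cancel f g -> hyp_act g (hyp_act f X) = X.
Proof.
move=> fK; rewrite -hyp_act_comp (_ : g \o f = id) ?hyp_act_id //.
exact/funext.
Qed.

Section Hyp.
Variables (L : language) (M : structure L) (I : Type)
  (F : (I -> M) -> (I -> M) -> Prop).
Hypothesis hF : typedef_equiv F.

Lemma hyp_refl c : F c c.
Proof. by have [_ [r _ _]] := hF; exact: r. Qed.

Lemma hyp_eqP c d : hyp F c = hyp F d <-> F c d.
Proof.
have [_ [r s t]] := hF; split=> [E|cd]; first by have : hyp F d d := r d; rewrite -E.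
apply/seteqP; split=> x; rewrite /hyp /= => H; [exact: t (s _ _ cd) H|exact: t cd H].
Qed.

Lemma typedef_aut f c d : automorphism f -> F (f \o c) (f \o d) <-> F c d.
Proof.
move=> autf; have [[Phi PhiP] _] := hF; rewrite !PhiP.
have E c' d' phi : sat phi (fun x : I + I => match x with
    | inl i => c' i | inr i => d' i end) = sat (M := M) phi (c' +:+ d') by [].
by split=> H phi /H; rewrite !E -comp_glue aut_sat.
Qed.

Lemma hyp_act_hyp f c : automorphism f -> hyp_act f (hyp F c) = hyp F (f \o c).
Proof.
move=> autf; apply/seteqP; split=> [_ [d cd <-]|d fcd].
  exact/(typedef_aut _ _ autf).
have [[g fK gK] _ _] := autf.
have E : f \o (g \o d) = d by apply/funext => i /=; rewrite gK.
by exists (g \o d) => //; apply/(typedef_aut _ _ autf); rewrite E.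
Qed.

End Hyp.

Section AutOver.
Variables (K : Type) (L : language) (M : structure L) (J : Type)
  (e : set (J -> M)).

Lemma aut_over_comp f g : aut_over e f -> aut_over e g -> aut_over e (f \o g).
Proof.
move=> [af fe] [ag ge]; split; first exact: aut_comp.
by rewrite hyp_act_comp ge fe.
Qed.

Lemma aut_over_inv f g : aut_over e f -> cancel f g -> cancel g f ->
  aut_over e g.
Proof.
move=> [af fe] fK gK; split; first exact: aut_inv af fK gK.
by rewrite -{1}fe hyp_act_can.
Qed.

Lemma autf_aut_over f : autf_over K e f -> aut_over e f.
Proof.
elim=> {f} [//||f g _ + _|f g _ af fK gK].
- by split; [exact: aut_id|exact: hyp_act_id].
- exact: aut_over_comp.
- exact: aut_over_inv af fK gK.
Qed.

Lemma autf_inverse f : autf_over K e f ->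
  exists g, [/\ autf_over K e g, cancel f g & cancel g f].
Proof.
move=> af; have [[[g fK gK] _ _] _] := autf_aut_over af.
by exists g; split=> //; exact: autf_inv af fK gK.
Qed.

Variables (I : Type) (F : (I -> M) -> (I -> M) -> Prop).
Hypothesis hF : typedef_equiv F.

Notation dist_le := (lascar_dist_le e F).

Lemma indiscernible_const c : indiscernible e F (fun=> c).
Proof.
move=> n t _; exists id => [|k]; last exact: hyp_act_id.
by split; [exact: aut_id|exact: hyp_act_id].
Qed.

Lemma indiscernible_aut s f : aut_over e f -> indiscernible e F s ->
  indiscernible e F (fun k => f \o s k).
Proof.
move=> af ind n t /ind [h ah hs]; have [[[g fK gK] _ _] _] := af.
exists (f \o (h \o g)) => [|k].
  exact: (aut_over_comp af (aut_over_comp ah (aut_over_inv af fK gK))).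
have fE c := hyp_act_hyp hF c af.1.
rewrite -(fE (s k)) -(fE (s (t k))) -hs (hyp_act_comp f) (hyp_act_comp h).
by rewrite (hyp_act_can _ fK).
Qed.

Lemma dist_le_refl c d n : F c d -> dist_le c d n.
Proof.
move=> cd; exists (fun=> c); split=> // [|i _]; first exact/hyp_eqP.
by exists (fun=> c); split=> //; exact: indiscernible_const.
Qed.

Lemma dist_le_step s c d : indiscernible e F s -> s 0 = c -> s 1 = d ->
  dist_le c d 1.
Proof.
move=> ind s0 s1; exists s; split; rewrite ?s0 ?s1 // => -[|//] _.
by exists s; split; rewrite ?s0 ?s1.
Qed.

Lemma dist_le_trans c d d' n m :
  dist_le c d n -> dist_le d d' m -> dist_le c d' (n + m).
Proof.
move=> [u [u0 un us]] [v [v0 vm vs]].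
exists (fun k => if k < n then u k else v (k - n)); split.
- by case: n un {us} => [|n] un //=; rewrite subn0 v0 -un u0.
- by rewrite ltnNge leq_addr /= addKn.
- move=> i inm; have [lt_in|le_ni] := ltnP i n.
    have [s [ind s0 s1]] := us i lt_in; exists s; split=> //.
    have [//|le_ni] := ltnP i.+1 n; have ni : n = i.+1 by lia.
    by rewrite -ni subnn v0 s1 -un ni.
  have [|s [ind s0 s1]] := vs (i - n); first by lia.
  exists s; split=> //; rewrite ltnNge (leq_trans le_ni (leqnSn i)) /=.
  by rewrite subSn.
Qed.

Lemma dist_le_mono c d n m : n <= m -> dist_le c d n -> dist_le c d m.
Proof.
move=> nm cd; rewrite -(subnKC nm); apply: dist_le_trans cd _.
exact: dist_le_refl (hyp_refl hF d).
Qed.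

Lemma dist_le_aut f c d n : aut_over e f -> dist_le c d n ->
  dist_le (f \o c) (f \o d) n.
Proof.
move=> af [u [u0 un us]]; exists (fun k => f \o u k).
have tr x y : hyp F x = hyp F y -> hyp F (f \o x) = hyp F (f \o y).
  by move=> xy; rewrite -!(hyp_act_hyp hF _ af.1) xy.
split; [exact: tr|exact: tr|].
move=> i /us[s [ind s0 s1]]; exists (fun k => f \o s k).
by split; [exact: indiscernible_aut|exact: tr|exact: tr].
Qed.

(** Symmetry is built in: reversing an indiscernible sequence is a matter of
    compactness for real tuples, whereas the distance is defined by sequences
    of hyperimaginaries. *)
Definition sdist_le c d n := dist_le c d n /\ dist_le d c n.

Lemma sdist_le_sym c d n : sdist_le c d n -> sdist_le d c n.
Proof. by case. Qed.

Lemma sdist_le_trans c d d' n m :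
  sdist_le c d n -> sdist_le d d' m -> sdist_le c d' (n + m).
Proof.
move=> [cd dc] [dd' d'd]; split; first exact: dist_le_trans cd dd'.
by rewrite addnC; exact: dist_le_trans d'd dc.
Qed.

Lemma sdist_le_mono c d n m : n <= m -> sdist_le c d n -> sdist_le c d m.
Proof. by move=> nm [cd dc]; split; exact: dist_le_mono nm _. Qed.

Lemma sdist_le_aut f c d n : aut_over e f -> sdist_le c d n ->
  sdist_le (f \o c) (f \o d) n.
Proof. by move=> af [cd dc]; split; exact: dist_le_aut. Qed.

Lemma sdist_le0 c d : F c d -> sdist_le c d 0.
Proof.
by move=> cd; split; apply: dist_le_refl => //; case: hF => _ [_ s _]; exact: s.
Qed.

(** A uniform bound is all there is to prove: distances are natural numbers,
    so a bounded nonempty set of them has a maximum. *)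
Lemma bounded_finite_diameter c N :
  (forall d, lascar_equiv K e (hyp F c) (hyp F d) -> dist_le c d N) ->
  finite_lascar_diameter K e F c.
Proof.
move=> bd.
have distP d : lascar_equiv K e (hyp F c) (hyp F d) ->
    exists2 m, lascar_dist e F c d m & m <= N.
  move=> /bd cdN; have exn : exists n, `[< dist_le c d n >].
    by exists N; apply/asboolP.
  case: (ex_minnP exn) => m /asboolP cdm min; exists m.
    by split=> // k cdk; apply: min; apply/asboolP.
  by apply: min; apply/asboolP.
have cc : lascar_equiv K e (hyp F c) (hyp F c).
  by exists id; [exact: autf_id|exact: hyp_act_id].
pose Q n := `[< exists2 d, lascar_equiv K e (hyp F c) (hyp F d) &
                           lascar_dist e F c d n >].
have exQ : exists n, Q n.
  have [m cm _] := distP _ cc.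
  by exists m; apply/asboolP; exists c.
have ubQ n : Q n -> n <= N.
  by move=> /asboolP[d cd [_ min]]; apply: min; exact: bd.
case: (ex_maxnP exQ ubQ) => n /asboolP Qn max; exists n; split=> // d cd.
have [m dm _] := distP _ cd; exists m => //.
by apply: max; apply/asboolP; exists d.
Qed.

End AutOver.

(** * A type-definable relation that generates the Lascar strong types *)

Section Near.
Variables (K : Type) (L : language) (M : structure L) (J I : Type).
Hypotheses (Knat : small K [set: nat]) (Msat : saturated K M)
  (Mhom : strongly_homogeneous K M).
Variables (E : (J -> M) -> (J -> M) -> Prop) (F : (I -> M) -> (I -> M) -> Prop).
Hypotheses (hE : typedef_equiv E) (hF : typedef_equiv F).
Hypotheses (sJ : small K [set: J]) (sI : small K [set: I]).
Variable a : J -> M.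

Notation e := (hyp E a).

(** Indiscernibility over the hyperimaginary is replaced by indiscernibility
    of real tuples over some representative of it, which is given by
    formulas. *)
Definition adjacent (x y : I -> M) := exists a' s,
  [/\ E a a', indisc a' s, s 0 = x & s 1 = y].

(** The relation between [x] and [f x] when [f] fixes a suitable model; it is
    symmetric for formal reasons. *)
Definition adjacent2 x y := exists z, adjacent x z /\ adjacent y z.

Lemma rep_aut_over a' f : E a a' -> automorphism f -> f \o a' = a' ->
  aut_over e f.
Proof.
move=> aa' autf fa'; split=> //.
have -> : e = hyp E a' by exact/(hyp_eqP hE).
by rewrite hyp_act_hyp // fa'.
Qed.

Lemma indisc_indiscernible a' s : E a a' -> indisc a' s -> indiscernible e F s.
Proof.
move=> aa' ind n t tincr.
pose th := ext_incr n (fun k => t (inord k)).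
have thincr : incr th.
  apply: incr_ext => i j ij; apply: tincr; rewrite !inordK //; lia.
have [|f [autf fs fa']] := homogeneous Knat Mhom (c := seqv s)
    (d := seqv (s \o th)) (w := a') (w' := a') (small_nat_mul Knat sI) sJ.
  by move=> phi; split=> /(ind th thincr).
exists f; first exact: rep_aut_over autf fa'.
move=> k; rewrite hyp_act_hyp //; congr (hyp F _).
have -> : t k = th k.
  have kn : k <= n by rewrite -ltnS.
  by rewrite /th /ext_incr kn inord_val.
by apply/funext => i; have /(congr1 (@^~ (nat_of_ord k, i))) := fs.
Qed.

Lemma adjacent_sdist x y : adjacent x y -> sdist_le e F x y 1.
Proof.
move=> [a' [s [aa' ind s0 s1]]]; split.
  exact: dist_le_step (indisc_indiscernible aa' ind) s0 s1.
have [r [indr r0 r1]] := indisc_swap Knat Msat Mhom sI sJ ind.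
apply: dist_le_step (indisc_indiscernible aa' indr) _ _; first by rewrite r0.
by rewrite r1.
Qed.

Lemma adjacent2_sdist x y : adjacent2 x y -> sdist_le e F x y 2.
Proof.
move=> [z [/adjacent_sdist xz /adjacent_sdist/sdist_le_sym zy]].
exact: sdist_le_trans xz zy.
Qed.

Lemma adjacent2_sym x y : adjacent2 x y -> adjacent2 y x.
Proof. by move=> [z [xz yz]]; exists z. Qed.

Variable b : I -> M.

Notation io := (a +:+ b).

Lemma closed_adjacent :
  closed_over io [set u : I + I -> M | adjacent (u \o inl) (u \o inr)].
Proof.
pose seqof (v : I + I + (nat * I + J) -> M) k i := v (inr (inl (k, i))).
pose D := [set v : I + I + (nat * I + J) -> M |
  E a (v \o inr \o inr) /\ (indisc (v \o inr \o inr) (seqof v) /\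
  forall i, v (inr (inl (0, i))) = v (inl (inl i)) /\
            v (inr (inl (1, i))) = v (inl (inr i)))].
have sw : small K [set: nat * I + J].
  by apply: (small_add Knat) => //; exact: small_nat_mul.
apply: (@closed_ext _ _ _ _ _ [set u | exists w, D (u +:+ w)]).
  move=> u; split=> [[w [aw [ind s01]]]|[a' [s [aa' ind s0 s1]]]].
    exists (w \o inr), (fun k i => w (inl (k, i))); split=> //.
      by apply/funext => i; have [? _] := s01 i.
    by apply/funext => i; have [_ ?] := s01 i.
  exists (seqv s +:+ a'); split=> //; split=> // i /=.
  by rewrite /seqv /= s0 s1.
apply: (closed_proj Knat Msat Mhom) => //;
  [exact: (small_add Knat)|exact: (small_add Knat)|].
apply: closed_and; [|apply: closed_and].
- have [[Phi PhiP] _] := hE.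
  pose g (x : J + J) : I + I + (nat * I + J) + (J + I) :=
    match x with inl j => inr (inl j) | inr j => inl (inr (inr j)) end.
  apply: (@closed_ext _ _ _ _ _ [set v | forall phi, forall _ : Phi phi,
      sat phi ((v +:+ io) \o g)]); last first.
    by apply: closed_forall => phi; apply: closed_forall => _; exact: closed_sat.
  move=> v; have gE : (v +:+ io) \o g = a +:+ (v \o inr \o inr).
    by apply/funext => -[].
  by rewrite PhiP; split=> H phi /H; rewrite gE.
- pose g (f : nat -> nat) (x : nat * I + J) :
      I + I + (nat * I + J) + (J + I) := inl (inr (reindex f x)).
  apply: (@closed_ext _ _ _ _ _ [set v | forall t, forall _ : incr t, forall phi,
      sat phi ((v +:+ io) \o g t) <-> sat phi ((v +:+ io) \o g id)]); last first.
    apply: closed_forall => t; apply: closed_forall => _.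
    by apply: closed_forall => phi; exact: closed_sat_iff.
  have gE (f : nat -> nat) v : (v +:+ io) \o g f =
      seqv (seqof v \o f) +:+ (v \o inr \o inr).
    by apply/funext => -[[k i]|j].
  by move=> v; split=> H t /H {}H phi; have := H phi; rewrite !gE.
- apply: closed_forall => i; apply: closed_and.
    exact: (@closed_eq _ _ _ io _ (inl (inr (inl (0, i)))) (inl (inl (inl i)))).
  exact: (@closed_eq _ _ _ io _ (inl (inr (inl (1, i)))) (inl (inl (inr i)))).
Qed.

Lemma closed_adjacent2 :
  closed_over io [set u : I + I -> M | adjacent2 (u \o inl) (u \o inr)].
Proof.
pose D := [set v : I + I + I -> M |
  adjacent (v \o inl \o inl) (v \o inr) /\ adjacent (v \o inl \o inr) (v \o inr)].
apply: (@closed_proj _ _ _ Knat Msat Mhom _ _ _ _ D) => //;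
  [exact: (small_add Knat)|exact: (small_add Knat)|].
pose g (h : I -> I + I) (x : I + I) : I + I + I + (J + I) :=
  match x with inl i => inl (inl (h i)) | inr i => inl (inr i) end.
apply: closed_and.
  have := closed_preimage (g := g inl) closed_adjacent; exact.
have := closed_preimage (g := g inr) closed_adjacent; exact.
Qed.

(** Balls around [b] for the distance that counts [adjacent2] steps. They are
    type-definable by construction, and contained in balls for the Lascar
    distance. *)
Fixpoint reach n : set (I -> M) :=
  if n is m.+1 then [set x | exists y, reach m y /\ adjacent2 y x]
  else [set x | F b x].

Lemma closed_reach n : closed_over io (reach n).
Proof.
elim: n => [|n IH].
  have [[Phi PhiP] _] := hF.
  pose g (x : I + I) : I + (J + I) :=
    match x with inl i => inr (inr i) | inr i => inl i end.
  apply: (@closed_ext _ _ _ _ _ [set v | forall phi, forall _ : Phi phi,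
      sat phi ((v +:+ io) \o g)]); last first.
    by apply: closed_forall => phi; apply: closed_forall => _; exact: closed_sat.
  move=> v; have gE : (v +:+ io) \o g = b +:+ v by apply/funext => -[].
  by rewrite /= PhiP; split=> H phi /H; rewrite gE.
pose D := [set v : I + I -> M |
  reach n (v \o inr) /\ adjacent2 (v \o inr) (v \o inl)].
apply: (@closed_proj _ _ _ Knat Msat Mhom _ _ _ _ D) => //;
  first exact: (small_add Knat).
pose g (x : I + I) : I + I + (J + I) :=
  match x with inl i => inl (inr i) | inr i => inl (inl i) end.
apply: closed_and.
  have := closed_preimage (g := fun i : I => inl (inr i) : I + I + (J + I)) IH; exact.
have := closed_preimage (g := g) closed_adjacent2; exact.
Qed.

Lemma reach_sdist n x : reach n x -> sdist_le e F b x (2 * n).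
Proof.
elim: n x => [|n IH] x /=; first exact: sdist_le0.
move=> [y [/IH by_ /adjacent2_sdist yx]]; rewrite mulnS addnC.
exact: sdist_le_trans by_ yx.
Qed.

End Near.

(** * Coheirs and Morley sequences *)

Lemma ultraC T (U : set_system T) (A : set T) : UltraFilter U ->
  U (~` A) <-> ~ U A.
Proof.
move=> ultraU; split=> [UnA UA|nUA]; last by have [] := in_ultra_setVsetC A ultraU.
by have [x []] := filter_ex (filterI UA UnA).
Qed.

Definition scons X (u : X) (v : nat -> X) (k : nat) : X :=
  if k is k'.+1 then v k' else u.

Section Power.
Variables (T : Type) (U : set_system T) (t0 : T).
Hypothesis ultraU : UltraFilter U.

(** The iterated quantifier [U v_(n-1), ..., U v_0]. The first term of the
    sequence is the innermost variable: a term of a Morley sequence realizes a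
    type over the earlier terms, which is evaluated by fixing the later ones in
    [T]. *)
Fixpoint power n (S : set (nat -> T)) : Prop :=
  if n is m.+1 then power m [set v | U [set u | S (scons u v)]]
  else S (fun=> t0).

Lemma power_mono n S S' : S `<=` S' -> power n S -> power n S'.
Proof.
elim: n S S' => [|n IH] S S' SS' /=; first exact: SS'.
by apply: IH => v; apply: filterS => u; exact: SS'.
Qed.

Lemma power_ext n S S' : (forall v, S v <-> S' v) -> power n S <-> power n S'.
Proof. by move=> SS'; split; apply: power_mono => v /SS'. Qed.

Lemma power_and n S S' : power n S -> power n S' -> power n (S `&` S').
Proof.
elim: n S S' => [|n IH] S S' //= H H'.
by apply: power_mono (IH _ _ H H') => v [Su S'u]; exact: filterI.
Qed.

Lemma power_setT n : power n setT.
Proof.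
elim: n => [//|n IH] /=; apply: power_mono IH => v _.
by apply: filterS filterT.
Qed.

Lemma power_set0 n : ~ power n set0.
Proof.
elim: n => [//|n IH] /= H; apply: IH; apply: power_mono H => v.
exact: filter_not_empty.
Qed.

Lemma power_not n S : power n (~` S) <-> ~ power n S.
Proof.
elim: n S => [//|n IH] S /=; rewrite -IH; apply: power_ext => v /=.
exact: (ultraC [set u | S (scons u v)] ultraU).
Qed.

Definition depends n (S : set (nat -> T)) :=
  forall v w, (forall k, k < n -> v k = w k) -> S v -> S w.

Lemma ultra_cst (Q : Prop) : U [set _ | Q] <-> Q.
Proof.
split=> [/filter_ex[]//|q]; apply: filterS filterT => ? _; exact: q.
Qed.

(** Quantifiers over variables that do not occur can be dropped, hence the
    power types are invariant under increasing changes of indices. *)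
Lemma power_incr m n t S : incr t -> depends n S ->
  (forall k, k < n -> t k < m) ->
  power m [set v : nat -> T | S (v \o t)] <-> power n S.
Proof.
elim: m n t S => [|m IH] n t S tincr dS tm.
  case: n dS tm => [|n] dS tm; last by have := tm 0 isT.
  by [].
have pos k : t 0 <= t k by case: k => [//|k]; exact/ltnW/tincr.
have [t0_gt|] := ltnP 0 (t 0).
  have tE k : t k = (t k).-1.+1 by have := pos k; lia.
  rewrite -(IH n (fun k => (t k).-1)) //=.
  - apply: power_ext => v /=; rewrite -[X in _ <-> X]ultra_cst.
    suff -> : [set u | S (scons u v \o t)] = [set _ | S (v \o (fun k => (t k).-1))] by [].
    apply/funext => u /=; congr S; apply/funext => k /=.
    by rewrite tE /=.
  - by move=> i j ij /=; have := tincr _ _ ij; have := pos i; lia.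
  - by move=> k kn; have := tm k kn; have := pos k; lia.
rewrite leqn0 => /eqP t00; case: n dS tm => [|n] dS tm.
  rewrite -(IH 0 t S) //=; apply: power_ext => v /=.
  rewrite -[X in _ <-> X]ultra_cst.
  by split; apply: filterS => u; exact: dS.
have t_gt k : 0 < t k.+1 by rewrite -t00; exact: tincr.
rewrite [power n.+1 S]/= -(IH n (fun k => (t k.+1).-1)) /=.
- apply: power_ext => v /=.
  suff -> : [set u | S (scons u v \o t)] =
    [set u | S (scons u (v \o (fun k => (t k.+1).-1)))] by [].
  apply/funext => u /=; congr S; apply/funext => -[|k] /=; first by rewrite t00.
  by rewrite -[t k.+1]prednK.
- move=> i j ij /=; have /tincr : i.+1 < j.+1 by [].
  by have := t_gt i; lia.
- move=> v w vw; apply: filterS => u; apply: dS => -[|k] //= kn; exact: vw.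
- by move=> k kn; have := tm k.+1 kn; have := t_gt k; lia.
Qed.

Lemma power_stable n m S : depends n S -> n <= m -> power m S <-> power n S.
Proof.
move=> dS nm; apply: (@power_incr m n id) => // k kn.
exact: leq_trans kn nm.
Qed.

End Power.

Section Coheir.
Variables (K : Type) (L : language) (M : structure L) (I : Type).
Hypotheses (Knat : small K [set: nat]) (Msat : saturated K M)
  (Mhom : strongly_homogeneous K M) (sI : small K [set: I]).
Variables (N : structure L) (h : N -> M).
Hypotheses (elem : elementary h) (sN : small K [set: N]).

Lemma elementary_sat V (phi : formula L V) (v : V -> N) :
  sat phi v <-> sat phi (h \o v).
Proof.
have [n0] := carrier_inh N.
have /countable_injP[g ginj] := finite_set_countable (fv_finite phi).
have /choice[v' v'P] : forall k, exists n, forall x, fv phi x -> g x = k -> n = v x.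
  move=> k; have [[x [px gx]]|nx] := pselect (exists x, fv phi x /\ g x = k).
    exists (v x) => y py gy; congr v; apply: ginj; rewrite ?inE //.
    by rewrite gx gy.
  by exists n0 => x px gx; case: nx; exists x.
have vE x : fv phi x -> v' (g x) = v x by move=> px; exact: v'P.
rewrite (@sat_fv _ _ _ _ v (v' \o g)); last by move=> x /vE.
rewrite (@sat_fv _ _ _ _ (h \o v) ((h \o v') \o g)); last by move=> x /vE /= ->.
by rewrite -(sat_rename phi g v') -(sat_rename phi g (h \o v')); exact: elem.
Qed.

(** Existential quantifiers over the finitely many variables in [B] are
    eliminated one at a time, each by elementarity of [h]. *)
Lemma elementary_exists V (B : set V) : finite_set B ->
  forall (phi : formula L V) (v : V -> N) (w : V -> M),
  (forall x, ~ B x -> w x = h (v x)) -> sat phi w ->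
  exists2 v', (forall x, ~ B x -> v' x = v x) & sat phi (h \o v').
Proof.
elim/finite_set_ind: B / => [|x B IH] phi v w wv sw.
  exists v => //; suff <- : w = h \o v by [].
  by apply/funext => x; apply: wv.
have [||v1 v1v] := IH (FExVar x phi) v (upd x w (h (v x))).
- move=> y By; have [->|yx] := pselect (y = x); first by rewrite upd_same.
  by rewrite upd_other //; apply: wv => -[].
- apply/sat_ExVar; exists (w x); suff -> : upd x (upd x w (h (v x))) (w x) = w by [].
  by apply/funext => y; rewrite /upd; case: pselect => //= yx; rewrite yx.
rewrite -elementary_sat => /sat_ExVar[m sm].
exists (upd x v1 m); last by apply/elementary_sat.
move=> y nBy; rewrite upd_other; first by apply: v1v => By; apply: nBy; right.
by move=> yx; apply: nBy; left.
Qed.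

Definition coheir (U : set_system (I -> N)) (x : I -> M) :=
  forall phi : formula L (I + N), sat phi (x +:+ h) <->
    U [set v | sat phi ((h \o v) +:+ h)].

(** By [elementary_exists], every formula over the model that holds of [x] is
    also satisfied by a tuple of the model. *)
Lemma coheir_exists x : exists U, UltraFilter U /\ coheir U x.
Proof.
pose FF : set_system (I -> N) := [set T | exists2 phi : formula L (I + N),
  sat phi (x +:+ h) & [set v | sat phi ((h \o v) +:+ h)] `<=` T].
have [n0] := carrier_inh N.
have FFP : ProperFilter FF.
  split.
    move=> [phi sphi phi0].
    pose B : set (I + N) := fv phi `&` range inl.
    have fB : finite_set B by apply: finite_setIl; exact: fv_finite.
    pose x' i := if pselect (fv phi (inl i)) then x i else h n0.
    have x'E : sat phi (x' +:+ h).
      apply/(sat_fv (w := x +:+ h)) => // -[i|n] //= pi.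
      by rewrite /x'; case: pselect.
    have [|v v0 sv] := elementary_exists fB (v := (fun=> n0) +:+ id) _ x'E.
      move=> [i|n] //= nB; rewrite /x'; case: pselect => // pi.
      by case: nB; split=> //; exists i.
    apply: (phi0 (v \o inl)); move: sv; rewrite /=.
    congr (sat phi _); apply/funext => -[i|n] //=; rewrite v0 //.
    by move=> [_ []].
  split.
  - by exists (FTrue L _); [exact: sat_true|].
  - move=> A B [phi sphi phiA] [psi spsi psiB]; exists (FAnd phi psi).
      exact/sat_and.
    by move=> v /sat_and[v1 v2]; split; [exact: phiA|exact: psiB].
  - move=> A B AB [phi sphi phiA]; exists phi => // v /phiA; exact: AB.
have [U [ultraU FU]] := ultraFilterLemma FFP.
have UE phi : sat phi (x +:+ h) -> U [set v | sat phi ((h \o v) +:+ h)].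
  by move=> sphi; apply: FU; exists phi.
exists U; split=> // phi; split; first exact: UE.
move=> Uphi; apply: contrapT => /(UE (FNot phi)) Unphi.
exact: (ultraC _ ultraU).1 Unphi Uphi.
Qed.

Variables (U : set_system (I -> N)) (t0 : I -> N).
Hypothesis ultraU : UltraFilter U.

Notation pow := (power U t0).

Definition inN (P : Type) (w : P -> M) (phi : formula L (nat * I + P)) :=
  [set v : nat -> I -> N | sat phi (seqv (fun k => h \o v k) +:+ w)].

(** The sequence realizes the power type: it is a Morley sequence over [w] of
    the global coheir given by the ultrafilter. *)
Definition morley (P : Type) (w : P -> M) (s : nat -> I -> M) :=
  forall n (phi : formula L (nat * I + P)), below n phi ->
  (sat phi (seqv s +:+ w) <-> pow n (inN w phi)).

Lemma depends_inN P (w : P -> M) n (phi : formula L (nat * I + P)) :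
  below n phi -> depends n (inN w phi).
Proof.
move=> nphi v v' vv'; apply: (below_sat _ nphi _).1 => k kn.
by rewrite vv'.
Qed.

Lemma morley_exists P (w : P -> M) : small K [set: P] ->
  exists s, morley w s.
Proof.
move=> sP.
pose FF : set_system (nat * I -> M) := [set T | exists n0, forall n, n0 <= n ->
  pow n [set v | T (seqv (fun k => h \o v k))]].
have FFP : ProperFilter FF.
  split.
    by move=> [n /(_ n (leqnn n))]; exact: power_set0.
  split.
  - by exists 0 => n _; exact: power_setT.
  - move=> A B [n nA] [m mB]; exists (maxn n m) => k; rewrite geq_max.
    by move=> /andP[/nA Ak /mB Bk]; exact: power_and.
  - move=> A B AB [n nA]; exists n => k /nA; apply: power_mono => v; exact: AB.
have [r rP] := compactness Knat Msat w (small_nat_mul Knat sI) sP FFP.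
pose s k i := r (k, i).
have sr : seqv s = r by apply/funext => -[].
have toS n (phi : formula L (nat * I + P)) : below n phi -> pow n (inN w phi) ->
    sat phi (seqv s +:+ w).
  move=> nphi pn; rewrite sr; apply: rP; exists n => m nm.
  by apply/(power_stable t0 ultraU (depends_inN nphi) nm).
exists s => n phi nphi; split; last exact: toS.
move=> sphi; apply: contrapT => /(power_not t0 ultraU n).
have nphi' : below n (FNot phi) by move=> k i [/nphi|[]].
by move/(toS n (FNot phi) nphi'); apply.
Qed.

Lemma morley_indisc P (w : P -> M) s : morley w s -> indisc w s.
Proof.
move=> ms t tincr phi; have [n nphi] := below_ex phi.
have tb k : k < n.+1 -> t k < (t n).+1.
  by rewrite !ltnS leq_eqVlt => /orP[/eqP->//|/tincr/ltnW].
rewrite -sat_rename_seq (ms _ _ (below_rename nphi tb)) (ms _ _ nphi).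
rewrite -(power_incr t0 ultraU tincr (depends_inN (w := w) nphi) tb).
by apply: power_ext => v; exact: sat_rename_seq.
Qed.

Lemma morley_sub P P' (w : P -> M) (g : P' -> P) s :
  morley w s -> morley (w \o g) s.
Proof.
move=> ms n phi nphi.
pose g' (x : nat * I + P') : nat * I + P :=
  match x with inl y => inl y | inr p => inr (g p) end.
have gE (v : nat * I -> M) : (v +:+ w) \o g' = v +:+ (w \o g).
  by apply/funext => -[].
rewrite -gE -sat_rename (ms n).
  by apply: power_ext => v; rewrite /inN /= sat_rename gE.
move=> k i H; have [[y|//] /= yphi [yE]] := fv_rename H.
by move: yphi; rewrite yE; exact: nphi.
Qed.

Lemma morley_same_type P (w : P -> M) s s' : morley w s -> morley w s' ->
  same_type (seqv s +:+ w) (seqv s' +:+ w).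
Proof.
move=> ms ms' phi; have [n nphi] := below_ex phi.
by rewrite (ms _ _ nphi) (ms' _ _ nphi).
Qed.

(** The innermost quantifier of the power type asks for a formula over the model,
    the remaining variables being fixed in the model, so by [coheir] it can be
    replaced by an evaluation at [x]. *)
Lemma morley_cons x s : coheir U x -> morley (h +:+ x) s -> morley h (scons x s).
Proof.
move=> cUx ms n phi nphi.
rewrite -(power_stable t0 ultraU (depends_inN nphi) (leqnSn n)) /=.
pose g (y : nat * I + N) : nat * I + (N + I) := match y with
  | inl (k.+1, i) => inl (k, i) | inl (0, i) => inr (inr i)
  | inr p => inr (inl p) end.
have gE (v : nat -> I -> M) : (seqv v +:+ (h +:+ x)) \o g = seqv (scons x v) +:+ h.
  by apply/funext => -[[[|k] i]|p].
rewrite -gE -sat_rename (ms n).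
  apply: power_ext => v; rewrite /inN /= sat_rename gE.
  pose gv (y : nat * I + N) : I + N := match y with
    | inl (k.+1, i) => inr (v k i) | inl (0, i) => inl i
    | inr p => inr p end.
  have gvE (z : I -> M) : (z +:+ h) \o gv =
      seqv (scons z (fun k => h \o v k)) +:+ h.
    by apply/funext => -[[[|k] i]|p].
  rewrite -gvE -sat_rename cUx.
  suff -> : [set u | sat (rename phi gv) ((h \o u) +:+ h)] =
      [set u | sat phi (seqv (fun k => h \o scons u v k) +:+ h)] by [].
  apply/funext => u /=; apply/propext; rewrite sat_rename gvE.
  suff -> : scons (h \o u) (fun k => h \o v k) = fun k => h \o scons u v k by [].
  by apply/funext => -[].
move=> k i H; have [[[[|k'] i']|p] //= yphi [<- _]] := fv_rename H.
by apply: ltnW; exact: nphi yphi.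
Qed.

End Coheir.

Section Generators.
Variables (K : Type) (L : language) (M : structure L) (J I : Type).
Hypotheses (Knat : small K [set: nat]) (Msat : saturated K M)
  (Mhom : strongly_homogeneous K M).
Variable (E : (J -> M) -> (J -> M) -> Prop).
Hypothesis (hE : typedef_equiv E).
Hypotheses (sJ : small K [set: J]) (sI : small K [set: I]).
Variable a : J -> M.

(** If [x] and [x'] have the same type over a model, then a Morley sequence [s]
    over both of them, of a common coheir of their types, continues [x] as well
    as [x'] to an indiscernible sequence. A conjugate over the model of a
    Morley sequence over [a] shows that it is indiscernible over a
    representative of the hyperimaginary. *)
Lemma adjacent2_fixed_model f (A : set M) (x : I -> M) : automorphism f ->
  elementary_sub A -> small K A -> in_dcl (hyp E a) A -> fixes_pointwise A f ->
  adjacent2 E a x (f \o x).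
Proof.
move=> autf [N [h [elem hA]]] sA dclA fixA.
have hinj : injective h.
  move=> n n' hnn'.
  pose phi := FEq (Var L 0) (Var L 1) : formula L nat.
  exact: (elem phi (fun k => if k is 0 then n else n')).2 hnn'.
have sN : small K [set: N].
  apply: small_le sA; rewrite -hA.
  have injh : {in [set: N] &, injective h} by move=> n n' _ _; exact: hinj.
  by have := inj_card_eq injh; rewrite card_eq_le => /andP[].
have fh : f \o h = h by apply/funext => n; apply: fixA; rewrite -hA; exists n.
have [U [ultraU cUx]] := coheir_exists elem x.
have cUfx : coheir h U (f \o x).
  by move=> phi; rewrite -cUx -{1}fh -comp_glue aut_sat.
have [n0] := carrier_inh N; pose t0 (i : I) := n0.
have [s ms] : exists s, morley h U t0 (h +:+ (x +:+ (f \o x))) s.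
  apply: (morley_exists Knat Msat sI h t0 ultraU).
  exact: (small_add Knat sN (small_add Knat sI sI)).
have [s2 ms2] : exists s2, morley h U t0 (h +:+ a) s2.
  by apply: (morley_exists Knat Msat sI h t0 ultraU); exact: (small_add Knat sN sJ).
have conj c : morley h U t0 h c -> adjacent E a (c 0) (c 1).
  move=> mc.
  have [|g [autg gs gh]] := homogeneous Knat Mhom (small_nat_mul Knat sI) sN
      (c := seqv s2) (d := seqv c) (w := h) (w' := h).
    apply: (morley_same_type _ mc).
    exact: (morley_sub ultraU inl ms2).
  have gc k : g \o s2 k = c k.
    by apply/funext => i; have /(congr1 (@^~ (k, i))) := gs.
  have ea : hyp_act g (hyp E a) = hyp E a.
    by apply: dclA autg _ => m; rewrite -hA => -[n _ <-]; have /(congr1 (@^~ n)) := gh.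
  exists (g \o a), c; split=> //.
    by apply/(hyp_eqP hE); rewrite -hyp_act_hyp.
  have -> : c = (fun k => g \o s2 k) by apply/funext.
  apply: aut_indisc => //; apply: (@morley_indisc _ _ _ _ _ U t0) => //.
  exact: (morley_sub ultraU inr ms2).
exists (s 0); split.
  apply: (conj (scons x s)); apply: morley_cons => //.
  have := morley_sub ultraU (fun y : N + I => match y with inl n => inl n
     | inr i => inr (inl i) end) ms.
  by congr (morley _ _ _ _ _); apply/funext => -[].
apply: (conj (scons (f \o x) s)); apply: morley_cons => //.
have := morley_sub ultraU (fun y : N + I => match y with inl n => inl n
   | inr i => inr (inr i) end) ms.
by congr (morley _ _ _ _ _); apply/funext => -[].
Qed.

Variables (F : (I -> M) -> (I -> M) -> Prop) (b : I -> M).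

(** Both directions are proved together, since the inverse of an automorphism
    exchanges them. *)
Lemma reach_autf f : autf_over K (hyp E a) f ->
  forall x, (exists n, reach E F a b n x) <-> (exists n, reach E F a b n (f \o x)).
Proof.
elim=> {f} [f A [autf _] Ael sA dclA fixA|//|f g _ IHf _ IHg|f g _ IHf fK gK] x.
- have xfx := adjacent2_fixed_model x autf Ael sA dclA fixA.
  split=> -[n nx]; exists n.+1; first by exists x.
  by exists (f \o x); split=> //; exact: adjacent2_sym.
- by rewrite IHg IHf.
- rewrite (IHf (g \o x)); suff -> : f \o (g \o x) = x by [].
  by apply/funext => i /=; rewrite gK.
Qed.

End Generators.

(** * Maximal invariant filters *)

Section MaxInvariant.
Variables (T : Type) (G : set (T -> T)) (X : set T).
Hypotheses (Gid : G id) (Gcomp : forall g h, G g -> G h -> G (g \o h)).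
Hypotheses (X0 : X !=set0) (GX : forall g x, G g -> X x -> X (g x)).

Definition invariant_filter (FF : set_system T) := [/\ ProperFilter FF, FF X &
  forall g S, G g -> FF S -> FF [set x | S (g x)]].

Lemma max_invariant_filter : exists FF, invariant_filter FF /\
  forall GG, invariant_filter GG -> FF `<=` GG -> GG `<=` FF.
Proof.
pose ok (FF : set_system T) := FF = set0 \/ invariant_filter FF.
have [FF [FFok FFmax]] : exists FF, ok FF /\ forall GG, FF `<` GG -> ~ ok GG.
  apply: Zorn_bigcup => C Cok Ctot.
  have [allempty|/existsNP[F0 /not_implyP[CF0 F0n]]] :=
      pselect (forall F0, C F0 -> F0 = set0).
    by left; apply/seteqP; split=> // S [F0 /allempty->].
  right; have [[p f] F0X _] : invariant_filter F0.
    by have [/F0n|] := Cok _ CF0.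
  have inv F1 : C F1 -> F1 !=set0 -> invariant_filter F1.
    by move=> /Cok[->|//] [S].
  split; first split.
  - by move=> [F1 CF1 F10]; have [[[]]] := inv _ CF1 (ex_intro _ _ F10).
  - split.
    + by exists F0 => //; exact: filterT.
    + move=> A B [F1 CF1 F1A] [F2 CF2 F2B].
      have [[_ i1] _ _] := inv _ CF1 (ex_intro _ _ F1A).
      have [[_ i2] _ _] := inv _ CF2 (ex_intro _ _ F2B).
      have [F12|F21] := Ctot _ _ CF1 CF2.
        by exists F2 => //; apply: filterI => //; exact: F12.
      by exists F1 => //; apply: filterI => //; exact: F21.
    + move=> A B AB [F1 CF1 F1A]; exists F1 => //.
      have [[_ i1] _ _] := inv _ CF1 (ex_intro _ _ F1A).
      exact: filterS F1A.
  - by exists F0.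
  - move=> g S Gg [F1 CF1 F1S]; exists F1 => //.
    by have [_ _ i1] := inv _ CF1 (ex_intro _ _ F1S); exact: i1.
have base : invariant_filter [set S | X `<=` S].
  split; first split.
  - by have [x Xx] := X0; move/(_ x Xx).
  - split.
    + by move=> x.
    + by move=> A B XA XB x Xx; split; [exact: XA|exact: XB].
    + by move=> A B AB XA x /XA/AB.
  - exact: subset_refl.
  - by move=> g S Gg XS x Xx; apply: XS; exact: GX.
have {}FFok : invariant_filter FF.
  case: FFok => // FF0; exfalso; apply: (FFmax [set S | X `<=` S]); last by right.
  rewrite FF0; split=> // sub; have := sub X; apply; exact: subset_refl.
exists FF; split=> // GG GGinv FG; apply: contrapT => GF.
by apply: (FFmax GG) => //; right.
Qed.

(** Maximality is minimality of the corresponding closed invariant set of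
    ultrafilters: the translates of an open set that meets it cover it. *)
Lemma max_invariant_cover FF S : invariant_filter FF ->
  (forall GG, invariant_filter GG -> FF `<=` GG -> GG `<=` FF) ->
  ~ FF (~` S) ->
  exists gs, [/\ finite_set gs, gs `<=` G & FF [set x | exists2 g, gs g & S (g x)]].
Proof.
move=> [pFF FFX FFinv] FFmax pos; apply: contrapT => ncov.
pose GG : set_system T := [set A | exists gs B, [/\ finite_set gs, gs `<=` G,
  FF B & B `&` [set x | forall g, gs g -> ~ S (g x)] `<=` A]].
apply: pos; apply: (FFmax GG); last first.
- exists [set id], setT; split; [exact: finite_set1|by move=> _ ->|exact: filterT|].
  by move=> x [_ /(_ id erefl)].
- by move=> A FFA; exists set0, A; split=> // x [].
split; first split.
- move=> [gs [B [fgs gsG FFB sub]]]; apply: ncov; exists gs; split=> //.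
  apply: filterS FFB => x Bx; apply: contrapT => nx; apply: (sub x); split=> //.
  by move=> g gsg Sgx; apply: nx; exists g.
- split.
  + by exists set0, setT; split=> //; exact: filterT.
  + move=> A A' [gs [B [fgs gsG FFB sub]]] [gs' [B' [fgs' gsG' FFB' sub']]].
    exists (gs `|` gs'), (B `&` B'); split.
    * by rewrite finite_setU.
    * by move=> g [/gsG|/gsG'].
    * exact: filterI.
    * move=> x [[Bx B'x] nS]; split; [apply: sub|apply: sub']; split=> // g gsg.
        by apply: nS; left.
      by apply: nS; right.
  + move=> A A' AA' [gs [B [fgs gsG FFB sub]]]; exists gs, B; split=> //.
    exact: subset_trans sub AA'.
- by exists set0, X; split=> // x [].
- move=> h A Gh [gs [B [fgs gsG FFB sub]]].
  exists [set g \o h | g in gs], [set x | B (h x)]; split.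
  + exact: finite_image.
  + by move=> _ [g /gsG Gg <-]; exact: Gcomp.
  + exact: FFinv.
  + move=> x [Bhx nS]; apply: sub; split=> // g gsg.
    by apply: (nS (g \o h)); exists g.
Qed.

End MaxInvariant.

Lemma ultra_finite_union T W (U : set_system T) (gs : set W) (S : W -> set T) :
  UltraFilter U -> finite_set gs -> U [set x | exists2 g, gs g & S g x] ->
  exists2 g, gs g & U (S g).
Proof.
move=> ultraU fgs; elim/finite_set_ind: gs / fgs => [|g gs IH].
  by move=> /filter_ex[x []].
have [Ug|Ung] := in_ultra_setVsetC (S g) ultraU; first by exists g => //; left.
move=> UU; have [|g' gsg' Ug'] := IH; last by exists g' => //; right.
apply: filterS (filterI Ung UU) => x [nSx [g' [->//|gsg'] Sx]].
by exists g'.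
Qed.

(** * The diameter of a type-definable Lascar strong type *)

Section Main.
Variables (K : Type) (L : language) (M : structure L) (J I : Type).
Hypotheses (Knat : small K [set: nat]) (Msat : saturated K M)
  (Mhom : strongly_homogeneous K M).
Variables (E : (J -> M) -> (J -> M) -> Prop) (F : (I -> M) -> (I -> M) -> Prop).
Hypotheses (hE : typedef_equiv E) (hF : typedef_equiv F).
Hypotheses (sJ : small K [set: J]) (sI : small K [set: I]).
Variables (a : J -> M) (b : I -> M).

Notation e := (hyp E a).
Notation io := (a +:+ b).
Notation autf := (autf_over K e).
Notation sdist := (sdist_le e F).
Notation reachn := (reach E F a b).

Definition lstp : set (I -> M) := [set d | lascar_equiv K e (hyp F d) (hyp F b)].

Lemma lstp_b : lstp b.
Proof. by exists id; [exact: autf_id|exact: hyp_act_id]. Qed.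

Lemma lstp_reach d : lstp d -> exists n, reachn n d.
Proof.
move=> [f af fd]; have autf_f := (autf_aut_over af).1.
apply/(reach_autf Knat Msat Mhom hE sJ sI F b af d); exists 0.
by apply/(hyp_eqP hF); rewrite -fd hyp_act_hyp.
Qed.

Lemma lstp_autf g d : autf g -> lstp d -> lstp (g \o d).
Proof.
move=> ag [f af fd]; have [g' [ag' gK g'K]] := autf_inverse ag.
exists (f \o g'); first exact: autf_comp.
rewrite -(hyp_act_hyp hF _ (autf_aut_over ag).1) (hyp_act_comp f).
by rewrite (hyp_act_can _ gK).
Qed.

Lemma lstp_sdist d : lstp d -> exists n, sdist b d n.
Proof.
move=> /lstp_reach[n bd]; exists (2 * n).
exact: (reach_sdist Knat Msat Mhom hE hF sJ sI bd).
Qed.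

(** The conditions on [p1 \o x] and [p2 \o x] are formulas in [x] once the
    automorphisms are moved to the parameters, which gives two conjugates of
    [io]; compactness applies over both together. *)
Lemma common_preimage (FF : set_system (I -> M)) (D : set (I -> M)) p1 p2 :
  ProperFilter FF -> closed_over io D -> automorphism p1 -> automorphism p2 ->
  (forall phi : formula L (I + (J + I)), (forall u, D u -> sat phi (u +:+ io)) ->
    FF [set x | sat phi ((p1 \o x) +:+ io)] /\
    FF [set x | sat phi ((p2 \o x) +:+ io)]) ->
  exists c, D (p1 \o c) /\ D (p2 \o c).
Proof.
move=> pFF cD a1 a2 FFD.
have [[q1 p1K q1K] _ _] := a1; have [[q2 p2K q2K] _ _] := a2.
have sP : small K [set: J + I] by exact: (small_add Knat sJ sI).
have [c cFF] := compactness Knat Msat ((q1 \o io) +:+ (q2 \o io)) sI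
  (small_add Knat sP sP) pFF.
have moved p q x (phi : formula L (I + (J + I))) : automorphism p ->
    cancel q p -> sat phi ((p \o x) +:+ io) <-> sat phi (x +:+ (q \o io)).
  move=> ap qK; rewrite -(aut_sat phi (x +:+ (q \o io)) ap) comp_glue.
  suff -> : p \o (q \o io) = io by [].
  by apply/funext => y /=; rewrite qK.
exists c; split; apply: cD => phi /FFD[FF1 FF2].
- pose g (y : I + (J + I)) : I + (J + I + (J + I)) :=
    match y with inl i => inl i | inr p => inr (inl p) end.
  have gE x : (x +:+ ((q1 \o io) +:+ (q2 \o io))) \o g = x +:+ (q1 \o io).
    by apply/funext => -[].
  apply/(moved _ _ _ _ a1 q1K); rewrite -gE -sat_rename; apply: cFF.
  apply: filterS FF1 => x /(moved _ _ _ _ a1 q1K).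
  by rewrite -gE -sat_rename.
- pose g (y : I + (J + I)) : I + (J + I + (J + I)) :=
    match y with inl i => inl i | inr p => inr (inr p) end.
  have gE x : (x +:+ ((q1 \o io) +:+ (q2 \o io))) \o g = x +:+ (q2 \o io).
    by apply/funext => -[].
  apply/(moved _ _ _ _ a2 q2K); rewrite -gE -sat_rename; apply: cFF.
  apply: filterS FF2 => x /(moved _ _ _ _ a2 q2K).
  by rewrite -gE -sat_rename.
Qed.

Definition act : set ((I -> M) -> (I -> M)) :=
  [set k | exists2 g, autf g & k = (fun x => g \o x)].

Lemma act_bounded gs : finite_set gs -> gs `<=` act ->
  exists N, forall k, gs k -> exists g g', [/\ k = (fun x => g \o x), autf g,
    autf g', cancel g g' /\ cancel g' g & sdist b (g' \o b) N].
Proof.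
move=> fgs; elim/finite_set_ind: gs / fgs => [|k gs IH] sub; first by exists 0.
have [N NP] := IH (fun x gx => sub x (or_intror gx)).
have [g ag kE] : act k by apply: sub; left.
have [g' [ag' gK g'K]] := autf_inverse ag.
have [n bn] := lstp_sdist (lstp_autf ag' lstp_b).
exists (maxn N n) => _ [->|/NP[h [h' [-> ah ah' hK bh]]]].
  exists g, g'; split=> //.
  by apply: sdist_le_mono bn; rewrite // leq_maxr.
exists h, h'; split=> //.
by apply: sdist_le_mono bh; rewrite // leq_maxl.
Qed.

(** The proof of Baire's theorem: if no [reachn n] contained the trace of an
    open set on the minimal set, then there would be a decreasing sequence of
    open sets, each meeting the minimal set, whose [n]-th term leaves
    [reachn n]; by compactness, a point of the Lascar strong type would be
    outside all of them. *)
Lemma reach_somewhere_dense FF A (pi0 : partial_type A I) :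
  small K A -> (forall d, realizes d pi0 <-> lstp d) ->
  invariant_filter act lstp FF ->
  exists n S, ~ FF (~` S) /\ forall phi : formula L (I + (J + I)),
    (forall u, reachn n u -> sat phi (u +:+ io)) ->
    FF [set x | S x -> sat phi (x +:+ io)].
Proof.
move=> sA pi0P [pFF FFX _]; apply: contrapT => none.
pose pos S := ~ FF (~` S).
have next (p : nat * set (I -> M)) : exists phi : formula L (I + (J + I)),
    pos p.2 -> (forall u, reachn p.1 u -> sat phi (u +:+ io)) /\
    ~ FF [set x | p.2 x -> sat phi (x +:+ io)].
  apply: contrapT => nophi; have posS : pos p.2.
    by apply: contrapT => nS; apply: nophi; exists (FTrue L _).
  apply: none; exists p.1, p.2; split=> // phi phiD.
  by apply: contrapT => nFF; apply: nophi; exists phi.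
have [phi phiP] := choice next.
pose S := fix S n : set (I -> M) := if n is m.+1
  then [set x | S m x /\ ~ sat (phi (m, S m)) (x +:+ io)] else lstp.
have posS n : pos (S n).
  elim: n => [|n IH].
    by move=> FFn; have [x []] := filter_ex (filterI FFX FFn).
  have [_ + FFS] := phiP (n, S n) IH; apply; apply: filterS FFS => x /= nS Sx.
  by apply: contrapT => nphi; apply: nS.
have Sdec n m : n <= m -> S m `<=` S n.
  elim: m => [|m IH]; first by rewrite leqn0 => /eqP->.
  by rewrite leq_eqVlt => /orP[/eqP->//|/IH sub x [/sub]].
pose FS : set_system (I -> M) := [set B | exists n, S n `<=` B].
have pFS : ProperFilter FS.
  split.
    move=> [n Sn]; apply: (posS n); apply: filterS filterT => x _ /Sn.
    by [].
  split.
  - by exists 0.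
  - move=> B B' [n nB] [m mB]; exists (maxn n m) => x Sx.
    split; [apply: nB|apply: mB].
      by apply: Sdec Sx; rewrite leq_maxl.
    by apply: Sdec Sx; rewrite leq_maxr.
  - by move=> B B' BB' [n nB]; exists n; exact: subset_trans nB BB'.
have sA' : small K [set: A].
  by move=> KA; apply: sA; rewrite -(card_le_eqr (card_setT A)).
have [c cFS] := compactness Knat Msat (@set_val _ A +:+ io) sI
  (small_add Knat sA' (small_add Knat sJ sI)) pFS.
have cX : lstp c.
  apply/pi0P => psi psi0.
  pose g (y : I + A) : I + (A + (J + I)) :=
    match y with inl i => inl i | inr p => inr (inl p) end.
  have gE x : (x +:+ (@set_val _ A +:+ io)) \o g = with_params x.
    by apply/funext => -[].
  rewrite -gE -sat_rename; apply: cFS; exists 0 => x /= /pi0P xpi.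
  by rewrite sat_rename gE; exact: xpi.
have [n cn] := lstp_reach cX.
have [phin _] := phiP (n, S n) (posS n).
pose g (y : I + (J + I)) : I + (A + (J + I)) :=
  match y with inl i => inl i | inr p => inr (inr p) end.
have gE x : (x +:+ (@set_val _ A +:+ io)) \o g = x +:+ io.
  by apply/funext => -[].
suff : sat (FNot (phi (n, S n))) (c +:+ io) by apply; exact: phin.
rewrite -gE -sat_rename; apply: cFS; exists n.+1 => x /= [_].
by rewrite sat_rename gE.
Qed.

(** With [p1 = g1] and [p2 = g2 h] sending [c] into [reachn n], the bound comes
    from the path from [b] to its image under the inverse of [g1], to [c], to
    the image of [b] under the inverse of [g2 h], and to that under the inverse
    of [h]. *)
Lemma lstp_bounded A (pi0 : partial_type A I) :
  small K A -> (forall d, realizes d pi0 <-> lstp d) ->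
  exists N, forall f, autf f -> sdist b (f \o b) N.
Proof.
move=> sA pi0P.
have act_id : act id by exists id => //; exact: autf_id.
have act_comp g h : act g -> act h -> act (g \o h).
  by move=> [g1 ag ->] [h1 ah ->]; exists (g1 \o h1) => //; exact: autf_comp.
have act_lstp g x : act g -> lstp x -> lstp (g x).
  by move=> [g1 ag ->]; exact: lstp_autf.
have [FF [FFinv FFmax]] := max_invariant_filter
   (ex_intro _ b lstp_b) act_lstp.
have [n [S [posS Sn]]] := reach_somewhere_dense sA pi0P FFinv.
have [gs [fgs gsG cov]] := max_invariant_cover act_id act_comp FFinv FFmax posS.
have [N NP] := act_bounded fgs gsG.
have [pFF _ FFact] := FFinv.
have [U [ultraU FU]] := ultraFilterLemma pFF.
exists (N + 2 * n + 2 * n + N) => f af.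
have [h [ah fK hK]] := autf_inverse af.
have [k1 gs1 U1] := ultra_finite_union ultraU fgs (FU _ cov).
have acth : act (fun x => h \o x) by exists h.
have [k2 gs2 U2] := ultra_finite_union ultraU fgs (FU _ (FFact _ _ acth cov)).
have [g1 [g1' [k1E ag1 ag1' [g1K g1'K] b1]]] := NP _ gs1.
have [g2 [g2' [k2E ag2 ag2' [g2K g2'K] b2]]] := NP _ gs2.
have [|||c [c1 c2]] := common_preimage (p1 := g1) (p2 := g2 \o h)
    (@ultra_proper _ _ ultraU)
    (closed_reach Knat Msat Mhom hE hF sJ sI (a := a) (b := b) (n := n)).
- exact: (autf_aut_over ag1).1.
- exact: (autf_aut_over (autf_comp ag2 ah)).1.
- move=> phi phiD; have Sphi := Sn phi phiD; split.
    have actk1 : act k1 by exact: gsG.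
    apply: filterS (filterI U1 (FU _ (FFact _ _ actk1 Sphi))) => x /= [Sx].
    by rewrite k1E in Sx *; exact.
  have actk2 : act (k2 \o (fun x => h \o x)).
    by apply: act_comp => //; exact: gsG.
  apply: filterS (filterI U2 (FU _ (FFact _ _ actk2 Sphi))) => x /= [Sx].
  by rewrite k2E in Sx *; exact.
have /(sdist_le_aut hF (autf_aut_over ag1')) d1 :=
  reach_sdist Knat Msat Mhom hE hF sJ sI c1.
have /(sdist_le_aut hF (autf_aut_over (autf_comp af ag2'))) d2 :=
  reach_sdist Knat Msat Mhom hE hF sJ sI c2.
have E1 : g1' \o (g1 \o c) = c by apply/funext => i /=; rewrite g1K.
have E2 : (f \o g2') \o ((g2 \o h) \o c) = c.
  by apply/funext => i /=; rewrite g2K hK.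
rewrite E1 in d1; rewrite E2 in d2.
have d3 := sdist_le_aut hF (autf_aut_over af) (sdist_le_sym b2).
apply: sdist_le_trans d3; apply: sdist_le_trans (sdist_le_sym d2).
exact: sdist_le_trans b1 d1.
Qed.

End Main.

Theorem theorem4p7 (K : Type) (L : language) (T : theory L) (M : structure L)
  (J I : Type)
  (E : (J -> M) -> (J -> M) -> Prop) (F : (I -> M) -> (I -> M) -> Prop)
  (a : J -> M) (b : I -> M)
  (hT : complete_theory T) (hM : monster K T M)
  (hJ : small K (@setT J)) (hI : small K (@setT I))
  (hE : typedef_equiv E) (hF : typedef_equiv F)
  (hpi : exists A : set M, small K A /\
     exists pi0 : partial_type A I, forall d : I -> M,
       realizes d pi0 <-> lascar_equiv K (hyp E a) (hyp F d) (hyp F b)) :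
  finite_lascar_diameter K (hyp E a) F b.
Proof.
have [[Knat _ _] [_ Msat Mhom]] := hM.
have [A [sA [pi0 pi0P]]] := hpi.
have [N NP] := lstp_bounded Knat Msat Mhom hE hF hJ hI sA pi0P.
apply: (@bounded_finite_diameter _ _ _ _ _ _ _ _ N) => d [f af fb].
rewrite -[N]addn0; apply: dist_le_trans (NP f af).1 _.
apply: dist_le_refl => //; apply/(hyp_eqP hF).
by rewrite -fb hyp_act_hyp //; exact: (autf_aut_over af).1.
Qed.
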